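(* Let $\gamma$ denote Euler's constant. There exist a real number $c$ and infinitely many integers $g$ such that $$4^gV_g\ \ge\ e^{\gamma}\,g\ln\ln g-cg.$$
   Context: Let $(A;L)$ be a principally polarized complex abelian variety of dimension $g\ge 1$. Put $T_A=\Gamma(A;\Omega_{A/\mathbb{C}})^\vee$ (the dual of the space of global holomorphic 1-forms, i.e. the tangent space at the origin), and let $\Gamma_A\subset T_A$ be the period lattice of $A$, so that $A(\mathbb{C})\simeq T_A/\Gamma_A$ as complex analytic groups. The polarization $L$ induces a Riemann form $\langle\ ;\ \rangle$ on $T_A$, i.e. a (positive definite) Hermitian inner product on $T_A$ such that $\mathrm{Im}\langle\gamma_1;\gamma_2\rangle\in\mathbb{Z}$ for all $(\gamma_1;\gamma_2)\in\Gamma_A^2$. For a lattice $\Gamma$ of an $n$-dimensional Euclidean space, $\lambda_1(\Gamma)=\min_{\gamma\in\Gamma\setminus\{0\}}\|\gamma\|$ is its first minimum, and its packing density $\Delta(\Gamma)$ is the density of the packing by balls of radius $\lambda_1(\Gamma)/2$ centred at the points of $\Gamma$. If $\Gamma$ has covolume 1, then $\Delta(\Gamma)=\frac{v_n}{2^n}\lambda_1(\Gamma)^n$, where $v_n$ is the volume of the unit ball of $\mathbb{R}^n$. The injectivity volume $V(A;L)$ is the packing density of the lattice $\Gamma_A$ in the Euclidean space $(T_A;\mathrm{Re}\langle\ ;\ \rangle)$, of real dimension $2g$. Equivalently, it is the largest volume of an open ball of $T_A$ that injects into $A$, with volume normalized so that $\Gamma_A$ has covolume 1. For an integer $g\ge1$,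 $V_g=\sup V(A;L)$, the supremum being over all principally polarized complex abelian varieties $(A;L)$ of dimension $g$. The constant $c$ does not depend on $g$. *)

(* Defs.v *)
From HB Require Import structures.
From mathcomp Require Import all_boot all_order all_algebra.
From mathcomp Require Import complex.
From mathcomp Require Import all_classical all_reals all_analysis.

Set Implicit Arguments.
Unset Strict Implicit.
Unset Printing Implicit Defensive.

Import Order.TTheory GRing.Theory Num.Theory.
Import numFieldNormedType.Exports.

Local Open Scope classical_set_scope.
Local Open Scope ring_scope.
Local Open Scope complex_scope.

Definition euler_gamma (R : realType) : R :=
  limn (fun n : nat => series (@harmonic R) n - ln n%:R).

(* n-dimensional Lebesgue measure: the n-fold product of the one-dimensional
   one (a point mass on the one-point space when n = 0). *)
Fixpoint lebesgue_tuple (R : realType) (n : nat) :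
    set (n.-tuple R) -> \bar R :=
  match n with
  | 0 => dirac [tuple]
  | m.+1 => pushforward
      (product_measure1 (@lebesgue_measure R) (@lebesgue_tuple R m))
      (fun p : R * m.-tuple R => [tuple of p.1 :: p.2])
  end.

(* C^g is identified with R^(2g) by listing the real parts of the coordinates,
   then their imaginary parts. *)
Definition tuple_to_Cg (R : realType) (g : nat) (t : (g + g).-tuple R) :
    'rV[R[i]]_g :=
  \row_(j < g) (tnth t (lshift g j) +i* tnth t (rshift g j)).

Definition Cg_volume (R : realType) (g : nat) (A : set 'rV[R[i]]_g) : \bar R :=
  lebesgue_tuple (@tuple_to_Cg R g @^-1` A).

(* The Z-span of an R-basis of C^g. *)
Definition is_lattice (R : realType) (g : nat) (G : set 'rV[R[i]]_g) : Prop :=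
  exists b : 'I_(2 * g) -> 'rV[R[i]]_g,
    (forall x, exists! a : {ffun 'I_(2 * g) -> R},
        x = \sum_(i < 2 * g) (a i)%:C *: b i) /\
    G = [set x | exists k : 'I_(2 * g) -> int,
                   x = \sum_(i < 2 * g) b i *~ k i].

(* A principally polarized abelian variety (A; L) of dimension g over the
   complex numbers, given by its analytic uniformization: the tangent space
   T_A = C^g, the period lattice, and the Riemann form of L (C-linear in its
   first argument).
   The polarization is principal when the isogeny from A to its dual is an
   isomorphism; the kernel of that isogeny is K(L) = Lambda(L) / period, with
   Lambda(L) = {x | Im <x; y> is an integer for every period y}. *)
Record ppav (R : realType) (g : nat) := Ppav {
  period : set 'rV[R[i]]_g;
  riemann : {dot 'rV[R[i]]_g for Num.conj};
  period_lattice : is_lattice period;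
  riemann_integral : forall x y, period x -> period y ->
    complex.Im (riemann x y) \is a Num.int;
  riemann_principal : forall x,
    (forall y, period y -> complex.Im (riemann x y) \is a Num.int) -> period x
}.

(* The norm of the Euclidean space (T_A; Re <;>). *)
Definition riemann_norm (R : realType) (g : nat)
    (H : {dot 'rV[R[i]]_g for Num.conj}) (x : 'rV[R[i]]_g) : R :=
  Num.sqrt (complex.Re (H x x)).

Definition riemann_ball (R : realType) (g : nat)
    (H : {dot 'rV[R[i]]_g for Num.conj}) (x : 'rV[R[i]]_g) (r : R) :
    set 'rV[R[i]]_g :=
  [set y | riemann_norm H (y - x) < r].

Definition lambda1 (R : realType) (g : nat)
    (H : {dot 'rV[R[i]]_g for Num.conj}) (G : set 'rV[R[i]]_g) : R :=
  inf [set riemann_norm H x | x in G `\ 0].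

(* The proportion of space covered by the balls of radius lambda1 / 2 centred
   at the points of G.  Being a ratio of volumes, it does not depend on the
   normalization of the Haar measure, so the volume of C^g need not be rescaled
   to the Euclidean structure given by H. *)
Definition packing_density (R : realType) (g : nat)
    (H : {dot 'rV[R[i]]_g for Num.conj}) (G : set 'rV[R[i]]_g) : \bar R :=
  let P := \bigcup_(x in G) riemann_ball H x (lambda1 H G / 2) in
  limf_esup (fun r : R => (Cg_volume (riemann_ball H 0 r `&` P) /
                           Cg_volume (riemann_ball H 0 r))%E)
            (+oo : set_system R).

Definition injectivity_volume (R : realType) (g : nat) (X : ppav R g) : \bar R :=
  packing_density (riemann X) (period X).

Definition sup_injectivity_volume (R : realType) (g : nat) : \bar R :=
  ereal_sup (range (@injectivity_volume R g)).

(* Main.v *)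
Require Import Defs.
From HB Require Import structures.
From mathcomp Require Import all_boot all_order all_algebra.
From mathcomp Require Import all_field complex ring lra zify.
From mathcomp Require Import all_classical all_reals all_analysis.
From mathcomp Require Import measurable_realfun.

Set Implicit Arguments.
Unset Strict Implicit.
Unset Printing Implicit Defensive.

Import Order.TTheory GRing.Theory Num.Theory.
Import numFieldNormedType.Exports.

Local Open Scope classical_set_scope.
Local Open Scope ring_scope.

(* Let g = phi(n).  A companion matrix C of the cyclotomic polynomial Phi_n acts
   on Z^g, and S = sum_j C^j (C^j)^T is an invariant Gram matrix.  For a real
   symmetric A, the lattice { x + i (y + x A) S^-1 : x, y in Z^g } of C^g with
   the Hermitian form of matrix S is a principally polarized abelian variety.
   When C A = A C^T, the map x |-> x C, (y + x A) |-> (y + x A) C^T is an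
   isometry of order n of this lattice, free on nonzero vectors.  It is not
   C-linear: it is self-adjoint for the symplectic form instead of preserving
   it, which is what leaves room for g free parameters, A being then a
   Hankel-like matrix.
   Replace S by S / m^2 and let A = hankel a / N with a in (Z/N)^g, N a large
   prime.  For x <> 0 the point (x, z/N) lies in the lattice of at most one a,
   so the lattices have on average at most vol(B) nonzero points in a ball B, up
   to an error that vanishes as m grows.  As nonzero vectors come by n, some
   lattice has none in a ball of volume close to n, whence 4^g V_g >= n.
   Finally n / phi(n) is large for primorials n = prod_(p <= e^k) p, by the
   lower bound in Mertens' third theorem, of which only arbitrarily large k are
   needed. *)

(** * A lower bound in Mertens' third theorem *)

(** The factor 4^g only turns the packing radius lambda/2 back into lambda, the real dimension being
    2g. Volumes of balls enter through ratios alone, so no formula for v_(2g) is involved. The two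
    scalings answer two obstacles. Vectors with x = 0 lie in the lattice of every slope, so
    averaging cannot remove them; dividing S by m^2 makes them at least as long as the target
    radius. And slopes of denominator N place all N^g lattices inside one lattice whose covolume is
    N^g times smaller, so that the mean value over slopes becomes a pigeonhole count in a single
    ball. The only error is the diameter of a tile of that fine lattice, of order 1/m once N >= m^2.
    A point (x, z) determines its slope because x A depends on a through multiplication by x in the
    domain Z[X]/Phi_n, whose determinant is non-zero and stays so modulo a large prime N. The final
    constant is 3 e^gamma: 2 comes from the loss 2/k in the Mertens bound, 1 from ln ln phi(n) <= k
    + 1. *)

Section EulerProduct.
Variables (R : realType) (f : nat -> R).
Hypothesis f1 : f 1%N = 1.
Hypothesis fM : forall m n, f (m * n)%N = f m * f n.
Hypothesis f_ge0 : forall n, 0 <= f n.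
Hypothesis f_lt1 : forall p, prime p -> f p < 1.

(** Peel off one prime p: the multiples of p contribute at most [f p] times the whole sum, so
    [1 - f p] times the sum is bounded by the product over the other primes. No geometric series has
    to be summed. *)
Lemma sum_le_euler_prod_seq (l : seq nat) (N : nat) : all prime l ->
  \sum_(m <- iota 1 N | all (mem l) (primes m)) f m
    <= \prod_(p <- l) (1 - f p)^-1.
Proof.
elim: l N => [|p l IH] N /=.
  move=> _; rewrite big_nil.
  rewrite (eq_bigl (fun m => m <= 1)%N); last first.
    move=> m; case: m => [|[|m]] //=; apply/negP => h.
    have : pdiv m.+2 \in primes m.+2 by rewrite mem_primes pdiv_prime //
      pdiv_dvd.
    by move/(allP h).
  case: N => [|N]; first by rewrite big_nil.
  rewrite /= big_cons /= f1 big1_seq ?addr0 // => m.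
  by rewrite mem_iota => /andP[h1 /andP[h2 _]]; move: h2; rewrite ltnNge h1.
case/andP => p_pr l_pr.
pose P m := all (mem (p :: l)) (primes m).
have P_ge0 (Q : pred nat) s : 0 <= \sum_(m <- s | Q m) f m by apply: sumr_ge0.
pose S M := \sum_(m <- iota 1 M | P m) f m.
rewrite big_cons -[X in X <= _]/(S N).
have S_homo M : (M <= N)%N -> S M <= S N.
  move=> leMN; rewrite /S -(subnKC leMN) iotaD big_cat /= lerDl; exact: P_ge0.
have h1 : \sum_(m <- iota 1 N | P m && ~~ (p %| m)%N) f m
    <= \prod_(q <- l) (1 - f q)^-1.
  apply: le_trans (IH N l_pr).
  rewrite [X in _ <= X](bigID (fun m => P m && ~~ (p %| m)%N)) /=.
  rewrite [X in _ <= X + _](eq_bigl (fun m => P m && ~~ (p %| m)%N)) ?lerDl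
    ?P_ge0 //.
  move=> m; apply: andb_idl => /andP[/allP Pm pm].
  apply/allP => q qm; move: (Pm _ qm); rewrite !inE => /orP[/eqP eqp|//].
  by move: qm pm; rewrite eqp mem_primes => /and3P[_ _ ->].
have h2 : \sum_(m <- iota 1 N | P m && (p %| m)%N) f m <= f p * S N.
  have p0 := prime_gt0 p_pr.
  rewrite -big_filter (perm_big (map (muln p)
     [seq m <- iota 1 (N %/ p) | P (p * m)%N])) /=; last first.
    apply: uniq_perm.
    - by rewrite filter_uniq // iota_uniq.
    - rewrite map_inj_uniq ?filter_uniq ?iota_uniq // => x y /eqP.
      by rewrite eqn_pmul2l // => /eqP.
    move=> m; rewrite mem_filter mem_iota; apply/idP/idP.
      case/andP=> /andP[Pm /dvdnP[k em]] /andP[m1 m2]; subst m.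
      apply/mapP; exists k; last by rewrite mulnC.
      rewrite mem_filter mulnC Pm mem_iota /=.
      rewrite add1n ltnS in m2; rewrite add1n ltnS leq_divRL // m2 andbT.
      by move: m1; rewrite muln_gt0 => /andP[].
    case/mapP => k; rewrite mem_filter mem_iota => /andP[Pk /andP[k1 k2]] ->.
    rewrite Pk dvdn_mulr // muln_gt0 p0 k1 /= add1n ltnS mulnC.
    by rewrite -leq_divRL.
  rewrite big_map big_filter.
  under eq_bigr do rewrite fM.
  rewrite -mulr_sumr; apply: ler_wpM2l => //.
  apply: le_trans (S_homo _ (leq_div N p)).
  rewrite /S [X in _ <= X](bigID (fun m => P (p * m)%N)) /=.
  rewrite big_seq_cond.
  rewrite [X in _ <= X + _](_ : _ =
     \sum_(m <- iota 1 (N %/ p) | (m \in iota 1 (N %/ p)) && P (p * m)%N) f m).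
    by rewrite lerDl P_ge0.
  rewrite big_seq_cond; apply: eq_bigl => m; rewrite mem_iota /P.
  case: (posnP m) => [->|m0] //=.
  case: (ltnP m (1 + _)) => //= _.
  apply: andb_idl => /allP h; apply/allP => q qm; apply: h.
  by rewrite primesM // qm orbT.
have h3 : S N <= \prod_(q <- l) (1 - f q)^-1 + f p * S N.
  by rewrite {1}/S (bigID (fun m => (p %| m)%N)) /= addrC; exact: lerD.
have fp1 : 0 < 1 - f p by rewrite subr_gt0 f_lt1.
by rewrite mulrC ler_pdivlMr // mulrBr mulr1 lerBlDr (mulrC (S N)).
Qed.

Lemma sum_le_euler_prod (N : nat) :
  \sum_(1 <= m < N.+1) f m <= \prod_(1 <= p < N.+1 | prime p) (1 - f p)^-1.
Proof.
rewrite /index_iota subSS subn0 -big_filter.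
apply: le_trans (sum_le_euler_prod_seq N (filter_all _ _)).
rewrite le_eqVlt; apply/orP; left; apply/eqP.
rewrite [LHS]big_seq [RHS]big_seq_cond; apply: eq_bigl => m.
rewrite mem_iota add1n ltnS; case: (boolP (_ && _)) => //= /andP[m1 m2].
apply/esym/allP => q; rewrite mem_primes => /and3P[q_pr m0 qm].
rewrite inE mem_filter q_pr mem_iota prime_gt0 //= add1n ltnS.
exact: leq_trans (dvdn_leq m0 qm) m2.
Qed.

End EulerProduct.

(** * Elementary bounds for logarithms, zeta sums and harmonic numbers *)

Section LogBounds.
Variable R : realType.
Implicit Types (r s : R).

(** The difference of the two sides vanishes at 0 and has derivative x^K / (1 - x) >= 0. *)
Lemma sum_exprn_div_le_ln (r : R) (K : nat) : 0 <= r < 1 ->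
  \sum_(i < K) r ^+ i.+1 / i.+1%:R <= - ln (1 - r).
Proof.
case/andP => r0 r1.
pose h (i : 'I_K) := fun x : R => (i.+1%:R)^-1 * x ^+ i.+1.
pose f := fun x : R => - ln (1 - x) - (\sum_(i < K) h i) x.
pose df (x : R) : R := (1 - x)^-1 - \sum_(i < K) x ^+ i.
have fE : forall x : R, x < 1 -> is_derive x 1 f (df x).
  move=> x x1.
  have x1' : 0 < 1 - x by rewrite subr_gt0.
  have hE i : is_derive x 1 (h i) (x ^+ i).
    have X := @is_deriveX R R id i.+1 x 1 1 (is_derive_id x 1).
    rewrite (_ : h i = i.+1%:R^-1 \*: ((id : R -> R) ^+ i.+1)); last first.
      by apply/funext => y; rewrite /h /= exprfctE.
    apply: (is_derive_eq (@is_deriveZ R R R _ i.+1%:R^-1 x 1 _ X)).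
    by rewrite scalerA mulrA mulVf ?mul1r ?pnatr_eq0 // [LHS]mulr1.
  have lE : is_derive x 1 (fun x : R => - ln (1 - x)) (1 - x)^-1.
    have dl := is_derive1_ln x1'.
    have := @is_derive1_comp R (@ln R) (fun y : R => 1 - y) x _ _ dl _.
    move=> /(_ (-1)) H.
    have /H {}H : is_derive x 1 (fun y : R => 1 - y) (-1).
      apply: (is_derive_eq (is_deriveB (is_derive_cst (1 : R) x 1)
        (is_derive_id x 1))).
      by rewrite sub0r.
    have := @is_deriveN R R R _ x 1 _ H.
    by rewrite mulrN1 opprK.
  rewrite /f /df.
  exact: (@is_deriveB R R R _ _ x 1 _ _ lE (is_derive_sum hE)).
have f0 : f 0 = 0.
  rewrite /f subr0 ln1 oppr0 sub0r fct_sumE big1 ?oppr0 // => i _.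
  by rewrite /h expr0n mulr0.
have [r_eq0|r_neq0] := eqVneq r 0.
  rewrite r_eq0 subr0 ln1 oppr0 big1 // => i _.
  by rewrite expr0n mul0r.
have r_gt0 : 0 < r by rewrite lt_neqAle eq_sym r_neq0.
have fD x : x \in `]0, r[%R -> is_derive x 1 f (df x).
  by rewrite in_itv /= => /andP[_ xr]; apply: fE; apply: lt_trans r1.
have fC : {within `[0, r], continuous f}.
  apply: derivable_within_continuous => x; rewrite in_itv /= => /andP[_ xr].
  have xD := fE x (le_lt_trans xr r1); exact: ex_derive.
have [c] := MVT r_gt0 fD fC.
rewrite in_itv /= => /andP[c0 cr]; rewrite f0 !subr0 => fr.
have c1 : 0 < 1 - c by rewrite subr_gt0 (lt_trans cr).
have : 0 <= f r.
  rewrite fr mulr_ge0 // /df subr_ge0 -[X in _ <= X]mul1r ler_pdivlMr //.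
  rewrite mulrC -opprB mulNr -subrX1 opprB gerBl.
  by rewrite exprn_ge0 // ltW.
rewrite /f subr_ge0; apply: le_trans.
by rewrite fct_sumE; apply: ler_sum => i _; rewrite /h mulrC.
Qed.

(** Concavity of [ln] at 1 - a b = b (1 - a) + (1 - b). With a = 1/p and b = p^(-s) it compares the
    Euler factor at 1 + s with the one at 1. *)
Lemma ln_Bernoulli (a b : R) : 0 <= a < 1 -> 0 <= b <= 1 ->
  - ln (1 - a * b) <= b * - ln (1 - a).
Proof.
case/andP=> a0 a1 /andP[b0 b1].
have a1' : 0 < 1 - a by rewrite subr_gt0.
pose t := Itv01 b0 b1.
have := @concave_ln R t (1 - a) 1 a1' ltr01.
rewrite !convRE /= ln1 mulr0 addr0 mulr1 /unstable.onem.
rewrite (_ : b * (1 - a) + (1 - b) = 1 - a * b); last by ring.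
by rewrite mulrN lerN2.
Qed.

(** The left side is the integral of x^(-1-s) over [1, N+1]. The induction step amounts to (1 +
    1/n)^(-s) >= 1 - s/n for n = N + 1. *)
Lemma sum_powRN_ge (s : R) (N : nat) : 0 < s ->
  (1 - powR N.+1%:R (- s)) / s <= \sum_(1 <= m < N.+1) powR m%:R (- (1 + s)).
Proof.
move=> s0; elim: N => [|N IH].
  by rewrite big_geq // powR1 subrr mul0r.
rewrite big_nat_recr //=.
apply: le_trans (lerD IH (lexx _)).
rewrite ler_pdivrMr // mulrDl divfK ?gt_eqF //.
have n0 : 0 < N.+1%:R :> R by rewrite ltr0n.
have e1 : powR (N.+1%:R : R) (- (1 + s)) = N.+1%:R^-1 * powR N.+1%:R (- s).
  by rewrite opprD powRD ?powR_inv1 ?ler0n // pnatr_eq0 implybT.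
have e2 : powR (N.+2%:R : R) (- s) =
   powR N.+1%:R (- s) * powR (1 + N.+1%:R^-1) (- s).
  rewrite -powRM ?ler0n ?addr_ge0 ?invr_ge0 ?ler0n //.
  by congr (powR _ _); rewrite mulrDr mulr1 divff ?gt_eqF // natr1.
have P0 : 0 < powR (N.+1%:R : R) (- s) by rewrite powR_gt0.
have h : 1 - s / N.+1%:R <= powR (1 + N.+1%:R^-1) (- s).
  rewrite /powR gt_eqF; last by rewrite ltr_wpDr // invr_ge0 ler0n.
  apply: le_trans (expR_ge1Dx _).
  rewrite lerD2l mulNr lerN2 ler_pM2l //.
  by apply: le_ln1Dx; rewrite (lt_trans (ltrN10 _)) // invr_gt0.
rewrite e1 e2 mulrAC.
move: (powR _ _) (powR _ _) h P0 => P Q h P0.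
have : (1 - s / N.+1%:R) * P <= Q * P by rewrite ler_wpM2r // ltW.
by rewrite mulrBl mul1r (mulrC Q) (mulrC s); move: (_ * s * P) (P * Q) => u w;
  lra.
Qed.

(** The shift skips the term of index 0, which is 0 by the convention [ln 0 = 0] and lies below the
    next term, 1. *)
Lemma harmonic_sub_ln_nonincreasing :
  nonincreasing_seq (fun n : nat => series (@harmonic R) n.+1 - ln n.+1%:R).
Proof.
apply/nonincreasing_seqP => n.
rewrite [X in X - _ <= _]seriesSr /=.
have n1 : 0 < n.+1%:R :> R by rewrite ltr0n.
have n2 : 0 < n.+2%:R :> R by rewrite ltr0n.
suff : n.+2%:R^-1 <= ln n.+2%:R - ln n.+1%:R :> R.
  by move: (series _ _) (ln _) (ln _) (_^-1) => a b c d; lra.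
rewrite -[X in X <= _]opprK lerNl -ln_div ?posrE //.
have -> : n.+2%:R / n.+1%:R = (1 - n.+2%:R^-1)^-1 :> R.
  have -> : n.+2%:R = n.+1%:R + 1 :> R by rewrite natr1.
  by field; rewrite ?gt_eqF //; lra.
have h : (n.+2%:R : R)^-1 < 1 by rewrite invf_lt1 // ltr1n.
rewrite lnV ?posrE ?subr_gt0 // opprK.
by apply: le_ln1Dx; rewrite ltrN2.
Qed.

Lemma harmonic_sub_ln_ge0 n : 0 <= series (@harmonic R) n.+1 - ln n.+1%:R.
Proof.
suff h m : ln m.+1%:R <= series (@harmonic R) m.
  rewrite subr_ge0; apply: le_trans (h n) _.
  by rewrite seriesSr lerDl harmonic_ge0.
elim: m => [|m IH]; first by rewrite ln1 /series /= big_geq.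
rewrite seriesSr /= -lerBlDl.
apply: le_trans (_ : ln m.+2%:R - ln m.+1%:R <= _); first by rewrite lerD2l
  lerN2.
have m1 : 0 < m.+1%:R :> R by rewrite ltr0n.
rewrite -ln_div ?posrE ?ltr0n //.
have -> : m.+2%:R / m.+1%:R = 1 + m.+1%:R^-1 :> R.
  have -> : m.+2%:R = m.+1%:R + 1 :> R by rewrite natr1.
  by field; rewrite gt_eqF.
by apply: le_ln1Dx; rewrite (lt_trans (ltrN10 _)) // invr_gt0.
Qed.

(** A nonincreasing sequence stays above its limit. This bound is the only access to Euler's
    constant in the proof. *)
Lemma euler_gamma_le (n : nat) : (0 < n)%N ->
  euler_gamma R <= series (@harmonic R) n - ln n%:R.
Proof.
case: n => // n _; rewrite /euler_gamma.
pose v := fun n : nat => series (@harmonic R) n.+1 - ln n.+1%:R.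
have cv : cvgn v.
  apply: nonincreasing_is_cvgn; first exact: harmonic_sub_ln_nonincreasing.
  by exists 0 => _ [m _ <-]; exact: harmonic_sub_ln_ge0.
have -> : limn (fun n : nat => series (@harmonic R) n - ln n%:R) = limn v.
  apply/cvg_lim => //.
  rewrite -(@cvg_shiftS R^o) /=.
  exact: cv.
exact: (nonincreasing_cvgn_ge harmonic_sub_ln_nonincreasing cv n).
Qed.

End LogBounds.

(** * Euler products sampled at e^k *)

Section Mertens.
Variable R : realType.
Implicit Types (r s : R).

Definition log_euler_prod (n : nat) : R :=
  \sum_(1 <= p < n.+1 | prime p) - ln (1 - p%:R^-1).

Definition expR_nat (k : nat) : nat := Num.truncn (expR k%:R : R).

Lemma expR_nat0 : expR_nat 0 = 1%N.
Proof. by rewrite /expR_nat expR0 truncn1. Qed.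

Lemma expR_natS k : (expR_nat k <= expR_nat k.+1)%N.
Proof. by apply: le_truncn; rewrite ler_expR ler_nat. Qed.

Lemma abel_expr (r : R) (u : nat -> R) (K : nat) :
  \sum_(0 <= k < K) r ^+ k * (u k.+1 - u k)
    = r ^+ K * u K - u 0%N + (1 - r) * \sum_(0 <= k < K) r ^+ k * u k.+1.
Proof.
elim: K => [|K IH]; first by rewrite !big_geq // expr0; ring.
by rewrite !big_nat_recr //= IH exprS; ring.
Qed.

Lemma inv_prime_bounds p : prime p -> 0 <= (p%:R^-1 : R) < 1.
Proof.
move=> pp; rewrite invr_ge0 ler0n /= invf_lt1 ?ltr1n ?prime_gt1 //.
by rewrite ltr0n prime_gt0.
Qed.

Lemma ln_inv_prime_ge0 p : prime p -> 0 <= - ln (1 - p%:R^-1) :> R.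
Proof.
by move=> /inv_prime_bounds /andP[p0 p1]; rewrite oppr_ge0 ln_le0 // gerBl.
Qed.

(** Cut the primes into blocks e^k < p <= e^(k+1), on which p^(-s) <= e^(-sk). *)
Lemma sum_prime_powRN_le (s : R) (K : nat) : 0 <= s ->
  \sum_(1 <= p < (expR_nat K).+1 | prime p)
      powR p%:R (- s) * - ln (1 - p%:R^-1)
    <= \sum_(0 <= k < K) expR (- s) ^+ k *
      (log_euler_prod (expR_nat k.+1) - log_euler_prod (expR_nat k)).
Proof.
move=> s0; elim: K => [|K IH].
  rewrite expR_nat0 [X in _ <= X]big_geq // big_nat_cond big_pred0 // => p.
  by case: p => [|[|p]].
have hK := expR_natS K.
rewrite (@big_cat_nat _ _ _ (expR_nat K).+1) //= big_nat_recr //=.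
apply: lerD => //.
have -> : log_euler_prod (expR_nat K.+1) - log_euler_prod (expR_nat K) =
    \sum_((expR_nat K).+1 <= p < (expR_nat K.+1).+1 | prime p)
      - ln (1 - p%:R^-1).
  rewrite /log_euler_prod (@big_cat_nat _ _ _ (expR_nat K).+1 1) //=.
  by rewrite addrAC subrr add0r.
rewrite mulr_sumr.
rewrite big_nat_cond [X in _ <= X]big_nat_cond; apply: ler_sum.
move=> p /andP[/andP[pK _] pp].
apply: ler_wpM2r; first exact: ln_inv_prime_ge0.
have : expR K%:R < p%:R :> R.
  by apply: (lt_le_trans (truncnS_gt _)); rewrite ler_nat.
move=> Kp; rewrite -expRM_natl !powRN mulrN expRN lef_pV2 ?posrE ?expR_gt0 //.
  rewrite expRM; apply: ge0_ler_powR; rewrite ?nnegrE ?expR_ge0 ?ler0n //.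
  exact: ltW.
by rewrite powR_gt0 // ltr0n prime_gt0.
Qed.

(** Logarithm of the truncated Euler product of zeta(1+s), each factor being compared with its value
    at 1 by [ln_Bernoulli]. *)
Lemma zeta_tail_le (s : R) (N : nat) : 0 < s ->
  ln ((1 - powR N.+1%:R (- s)) / s)
    <= \sum_(1 <= p < N.+1 | prime p) powR p%:R (- s) * - ln (1 - p%:R^-1).
Proof.
move=> s0.
pose f (m : nat) := powR (m%:R : R) (- (1 + s)).
have fE p : (0 < p)%N -> f p = p%:R^-1 * powR p%:R (- s).
  move=> p0; rewrite /f opprD powRD ?powR_inv1 ?ler0n // pnatr_eq0.
  by rewrite -lt0n p0 implybT.
have f1 : f 1%N = 1 by rewrite /f powR1.
have fM m n : f (m * n)%N = f m * f n.
  by rewrite /f natrM powRM ?ler0n.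
have f0 n : 0 <= f n by exact: powR_ge0.
have pw p : prime p -> 0 <= powR (p%:R : R) (- s) <= 1.
  move=> pp; rewrite powR_ge0 /= powRN invf_le1 ?powR_gt0 ?ltr0n ?prime_gt0 //.
  rewrite -[X in X <= _](powRr0 (p%:R : R)); apply: ler_powR; last exact: ltW.
  by rewrite ler1n prime_gt0.
have flt1 p : prime p -> f p < 1.
  move=> pp; rewrite fE ?prime_gt0 //.
  have /andP[a0 a1] := inv_prime_bounds pp; have /andP[b0 b1] := pw _ pp.
  by apply: le_lt_trans a1; rewrite ler_piMr.
have h := le_trans (sum_powRN_ge N s0) (sum_le_euler_prod f1 fM f0 flt1 N).
have : ln (\prod_(1 <= p < N.+1 | prime p) (1 - f p)^-1)
    <= \sum_(1 <= p < N.+1 | prime p) powR p%:R (- s) * - ln (1 - p%:R^-1).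
  have -> : ln (\prod_(1 <= p < N.+1 | prime p) (1 - f p)^-1) =
     \sum_(1 <= p < N.+1 | prime p) - ln (1 - f p).
    rewrite -[RHS]expRK expR_sum; congr ln.
    apply: eq_bigr => p pp; rewrite expRN lnK ?posrE // subr_gt0; exact: flt1.
  apply: ler_sum => p pp; rewrite fE ?prime_gt0 //.
  by apply: ln_Bernoulli; rewrite ?inv_prime_bounds ?pw.
apply: le_trans.
(* Only N = 0 falls in the first case; [ln] is then 0 and the product is at least 1. *)
have [h0|h0] := leP ((1 - powR N.+1%:R (- s)) / s) 0.
  rewrite (ln0 h0) -ln1.
  rewrite ler_ln ?posrE //.
    elim/big_ind: _ => // [x y x1 y1|p pp]; first by rewrite mulr_ege1.
    by rewrite invf_ge1 ?subr_gt0 ?flt1 // gerBl.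
  by apply: prodr_gt0 => p pp; rewrite invr_gt0 subr_gt0 flt1.
by rewrite ler_ln ?posrE //; exact: lt_le_trans h.
Qed.

(* If the claim failed from some point on, Abel summation against e^(-sk) would
   make the logarithm of zeta(1+s), which is at least ln (1/s), too small as
   s -> 0.  Sampling the primes at the integral points e^k lets the harmonic
   numbers, hence Euler's constant, enter through sum r^k H_k. *)
Lemma mertens_frequently (k0 : nat) : exists k : nat,
  [/\ (k0 <= k)%N, (0 < k)%N &
   ln k%:R + euler_gamma R - 2 / k%:R < log_euler_prod (expR_nat k)].
Proof.
apply: contrapT => /forallNP H.
pose P k := log_euler_prod (expR_nat k).
have P0 : P 0%N = 0.
  rewrite /P expR_nat0 /log_euler_prod big_nat_cond big_pred0 // => p.
  by case: p => [|[|p]].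
pose Hm := series (@harmonic R).
(* After summation the correction 2/k yields a gain of 2 (1 - r) L, which beats the (1 - r) L lost
   by multiplying the inequality through by r. *)
pose B0 k := Hm k - 2 / k%:R.
have PB0 k : (k0 <= k)%N -> (0 < k)%N -> P k <= B0 k.
  move=> kk k_gt0; have := H k; rewrite /P => Hk.
  have {}Hk : P k <= ln k%:R + euler_gamma R - 2 / k%:R.
    by rewrite leNgt; apply/negP => Hk'; apply: Hk.
  apply: le_trans Hk _; rewrite /B0 lerD2r -lerBrDl; exact: euler_gamma_le.
(* The bump [C0 * t k] absorbs the finitely many k < k0; it costs only C0 k0 (1 - r) in the end. *)
pose C0 := \sum_(0 <= k < k0) `|P k - B0 k|.
have C0_ge0 : 0 <= C0 by apply: sumr_ge0.
pose t k : R := (k < k0)%N%:R.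
have PB k : (0 < k)%N -> P k <= B0 k + C0 * t k.
  move=> k_gt0; rewrite /t; case: ltnP => kk; last first.
    by rewrite mulr0 addr0 PB0.
  rewrite mulr1 -lerBlDl; apply: le_trans (ler_norm _) _.
  rewrite /C0 (bigD1_seq k) ?iota_uniq ?mem_index_iota //= lerDl.
  exact: sumr_ge0.
(* Since 1 - r <= s, this forces L >= 4 + C0 k0, one more than the bound 3 + C0 k0 that closes the
   proof. *)
pose s : R := expR (- (4 + C0 * k0%:R)).
have s_gt0 : 0 < s by exact: expR_gt0.
have CK : 0 <= C0 * k0%:R by rewrite mulr_ge0.
have s_le : s <= 2^-1.
  rewrite /s expRN lef_pV2 ?posrE ?expR_gt0 //.
  apply: le_trans (expR_ge1Dx _); lra.
pose r := expR (- s).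
have r_gt0 : 0 < r by exact: expR_gt0.
have r_lt1 : r < 1 by rewrite expR_lt1 oppr_lt0.
have r_ge : 1 - s <= r by exact: expR_ge1Dx.
have rs_le : r * s <= 1 - r.
  have : r * (1 + s) <= 1.
    by rewrite -ler_pdivlMl // mulr1 /r expRN invrK expR_ge1Dx.
  by lra.
(* Truncating zeta(1+s) at e^K then costs only a factor 1 - s. *)
have [K [Kk0 Ks]] : exists K, (k0 <= K)%N /\ expR (- s) ^+ K <= s.
  exists (maxn k0 (Num.truncn (s^-1 * (4 + C0 * k0%:R))).+1).
  split; first exact: leq_maxl.
  rewrite -expRM_natl -[X in _ <= X]/(expR (- (4 + C0 * k0%:R))) ler_expR mulrN
    lerN2.
  rewrite -ler_pdivrMr // mulrC.
  apply: le_trans (ltW (truncnS_gt _)) _.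
  by rewrite ler_nat leq_maxr.
have h1 := zeta_tail_le (expR_nat K) s_gt0.
have h2 := le_trans h1 (sum_prime_powRN_le K (ltW s_gt0)).
have h3 : ln ((1 - s) / s) <= ln ((1 - powR (expR_nat K).+1%:R (- s)) / s).
  have e : powR (expR_nat K).+1%:R (- s) <= s.
    apply: le_trans Ks; rewrite -expRM_natl powRN mulrN expRN.
    rewrite lef_pV2 ?posrE ?expR_gt0 ?powR_gt0 ?ltr0n //.
    rewrite expRM; apply: ge0_ler_powR; rewrite ?nnegrE ?expR_ge0 ?ler0n //.
    exact: ltW (truncnS_gt _).
  rewrite ler_ln ?posrE ?divr_gt0 ?subr_gt0 //; [|lra|lra].
  by rewrite ler_wpM2r ?invr_ge0 ?(ltW s_gt0) // lerD2l lerN2.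
have {h1 h2 h3} h4 := le_trans h3 h2.
rewrite -/r in h4.
pose LK := \sum_(k < K) r ^+ k.+1 / k.+1%:R.
pose L := - ln (1 - r).
have LKL : LK <= L by apply: sum_exprn_div_le_ln; rewrite ltW.
have LK_ge0 : 0 <= LK.
  by apply: sumr_ge0 => k _; rewrite divr_ge0 // exprn_ge0 // ltW.
have h5 : \sum_(0 <= k < K) r ^+ k * (P k.+1 - P k)
    <= r^-1 * LK - 2 * (r^-1 * LK - LK) + C0 * ((1 - r) * k0%:R).
  (* The Abel form of the sum has non-negative weights except at index 0, so P may be replaced by a
     majorant that agrees with it there: hence the value 0 = P 0. *)
  pose B k := (if k is 0%N then 0 else B0 k + C0 * t k).
  have PB' k : P k <= B k by case: k => [|k]; rewrite ?P0 // PB.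
  apply: le_trans (_ : \sum_(0 <= k < K) r ^+ k * (B k.+1 - B k) <= _).
    rewrite !abel_expr P0 [B 0%N]/= lerD // ?lerD2r.
      by rewrite ler_wpM2l // exprn_ge0 // ltW.
    rewrite ler_wpM2l ?subr_ge0 ?(ltW r_lt1) //; apply: ler_sum => k _.
    by rewrite ler_wpM2l // exprn_ge0 // ltW.
  have BE k : B k = B0 k + C0 * (if k is 0%N then 0 else t k).
    case: k => [|k] //; rewrite /B0 invr0 mulr0 subr0 mulr0 addr0.
    by rewrite /Hm /series /= big_geq.
  under eq_bigr do rewrite !BE.
  pose t' k : R := if k is 0%N then 0 else t k.
  have -> : \sum_(0 <= k < K) r ^+ k *
      (B0 k.+1 + C0 * t k.+1 - (B0 k + C0 * t' k)) =
    \sum_(0 <= k < K) r ^+ k * k.+1%:R^-1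
    - 2 * (\sum_(0 <= k < K) r ^+ k * k.+1%:R^-1
      - \sum_(0 <= k < K) r ^+ k * k%:R^-1)
    + C0 * \sum_(0 <= k < K) r ^+ k * (t' k.+1 - t' k).
    rewrite -sumrB !mulr_sumr -sumrB -big_split /=; apply: eq_bigr => k _.
    rewrite /B0 /Hm seriesSr /harmonic /=.
    by move: (series _ _) (_^-1) (_^-1) => x y z; ring.
  have e1 : \sum_(0 <= k < K) r ^+ k * k.+1%:R^-1 = r^-1 * LK.
    rewrite /LK big_mkord mulr_sumr; apply: eq_bigr => k _.
    by rewrite exprS mulrA mulKf // gt_eqF.
  have e2 : \sum_(0 <= k < K) r ^+ k * k%:R^-1 <= LK.
    case: K {Kk0 Ks h4 e1 LKL} @LK LK_ge0 => [|K] LK LK_ge0.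
      by rewrite big_geq.
    rewrite big_mkord big_ord_recl invr0 mulr0 add0r /LK big_ord_recr /=.
    by rewrite lerDl divr_ge0 // exprn_ge0 // ltW.
  have e3 : \sum_(0 <= k < K) r ^+ k * (t' k.+1 - t' k) <= (1 - r) * k0%:R.
    rewrite abel_expr [t' 0%N]/= subr0.
    have -> : t' K = 0.
      by rewrite /t'; case: (K) Kk0 => [|K'] // Kk0; rewrite /t ltnNge Kk0.
    rewrite mulr0 add0r ler_wpM2l ?subr_ge0 ?(ltW r_lt1) //.
    apply: le_trans (_ : \sum_(0 <= k < K) t k.+1 <= _).
      apply: ler_sum => k _; rewrite ler_piMl // ?ler0n //.
      by rewrite exprn_ile1 // ltW.
    rewrite /t -natr_sum ler_nat.
    apply: leq_trans (_ : \sum_(0 <= k < k0) 1 <= _)%N; last first.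
      by rewrite sum_nat_const_nat muln1 subn0.
    rewrite (@big_cat_nat _ _ _ k0) //= [X in (_ + X)%N]big_nat_cond.
    rewrite [X in (_ + X)%N]big1 ?addn0; first by apply: leq_sum => k _; case:
      ltnP.
    by move=> k /andP[/andP[kk _] _]; rewrite ltnNge ltnW.
  rewrite e1; apply: lerD; last by rewrite ler_wpM2l.
  by rewrite lerD2l lerN2 ler_wpM2l // lerD2l lerN2.
have h6 : r * ln ((1 - s) / s) <= (1 - 2 * (1 - r)) * L + C0 * k0%:R * (1 - r).
  have h7 := le_trans h4 h5.
  have : r * ln ((1 - s) / s) <=
     r * (r^-1 * LK - 2 * (r^-1 * LK - LK) + C0 * ((1 - r) * k0%:R)).
    by rewrite ler_pM2l.
  move/le_trans; apply.
  have -> : r * (r^-1 * LK - 2 * (r^-1 * LK - LK) + C0 * ((1 - r) * k0%:R)) =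
     (1 - 2 * (1 - r)) * LK + r * (C0 * k0%:R * (1 - r)).
    by field; rewrite gt_eqF.
  apply: lerD; first by rewrite ler_wpM2l //; lra.
  rewrite ler_piMl ?(ltW r_lt1) // mulr_ge0 // subr_ge0 ltW //.
have h8 : L - 3 * s <= ln ((1 - s) / s).
  have s1 : 0 < 1 - s by lra.
  rewrite ln_div ?posrE //.
  have : ln s - s <= ln (1 - r).
    rewrite -[X in _ - X]opprK -(expRK (- s)) -/r opprK -lnM ?posrE //.
    rewrite ler_ln ?posrE ?mulr_gt0 ?subr_gt0 // mulrC; exact: rs_le.
  have : - ln (1 - s) <= 2 * s.
    rewrite -lnV ?posrE //.
    have -> : (1 - s)^-1 = 1 + s / (1 - s) by field; rewrite gt_eqF.
    apply: le_trans (_ : s / (1 - s) <= _).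
      by apply: le_ln1Dx; rewrite (lt_le_trans (ltrN10 _)) // divr_ge0 // ltW.
    rewrite ler_pdivrMr //; nra.
  by rewrite /L; lra.
have h9 : 4 + C0 * k0%:R <= L.
  rewrite -lerN2 opprK -[X in _ <= X]expRK ler_ln ?posrE ?subr_gt0 ?expR_gt0 //.
  by rewrite -/s; lra.
have h10 : r * (L - 3 * s) <= r * ln ((1 - s) / s) by rewrite ler_pM2l.
have h11 := le_trans h10 h6.
have : (1 - r) * L <= (1 - r) * (3 + C0 * k0%:R).
  by move: (C0 * k0%:R) h11 => D h11; nra.
rewrite ler_pM2l ?subr_gt0 // => h12; lra.
Qed.

End Mertens.

(** * Chebyshev's upper bound for primorials *)

Section Primorial.

Definition primorial (n : nat) : nat := (\prod_(1 <= p < n.+1 | prime p) p)%N.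

Lemma primorialS n :
  primorial n.+1 = (primorial n * (if prime n.+1 then n.+1 else 1))%N.
Proof.
rewrite /primorial big_mkcond big_nat_recr //= -big_mkcond /=.
by case: ifP.
Qed.

Lemma primorial_gt0 n : (0 < primorial n)%N.
Proof. by apply: prodn_cond_gt0 => p; exact: prime_gt0. Qed.

Lemma coprime_prime_prod (m n q : nat) : prime q -> (n <= q)%N ->
  coprime (\prod_(m <= p < n | prime p) p) q.
Proof.
move=> qp nq; rewrite big_nat_cond; elim/big_ind: _ => [|x y xq yq|p].
- exact: coprime1n.
- by rewrite coprimeMl xq.
- move=> /andP[/andP[_ pn] pp]; rewrite prime_coprime // dvdn_prime2 //.
  by rewrite neq_ltn (leq_trans pn nq).
Qed.

Lemma prime_prod_dvd (m n d : nat) :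
  (forall p, prime p -> (m <= p < n)%N -> (p %| d)%N) ->
  (\prod_(m <= p < n | prime p) p %| d)%N.
Proof.
elim: n => [|n IH] H; first by rewrite big_geq.
have [mn|nm] := leqP m n; last by rewrite big_geq.
have IH' : (\prod_(m <= p < n | prime p) p %| d)%N.
  by apply: IH => p pp /andP[mp pn]; apply: H => //; rewrite mp ltnW.
rewrite big_mkcond big_nat_recr //= -big_mkcond /=.
case: ifP => np; last by rewrite muln1.
rewrite Gauss_dvd; last exact: coprime_prime_prod.
by rewrite IH' /= H // mn ltnSn.
Qed.

(** Row 2m+1 of Pascal's triangle has two equal middle entries, and its sum is 2 * 4^m. *)
Lemma bin_middle_le (m : nat) : ('C(m.*2.+1, m) <= 4 ^ m)%N.
Proof.
rewrite -(@leq_pmul2l 2) //.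
have -> : (2 * 4 ^ m = 2 ^ m.*2.+1)%N.
  by rewrite expnS -mul2n expnM.
have := expnDn 1 1 m.*2.+1; rewrite addn1 => ->.
under eq_bigr do rewrite !exp1n !muln1.
have m1 : (m < m.*2.+2)%N by rewrite -addnn; lia.
have m2 : (m.+1 < m.*2.+2)%N by rewrite -addnn; lia.
rewrite (bigD1 (Ordinal m1)) //= (bigD1 (Ordinal m2)) //=; last first.
  by rewrite -val_eqE /= neq_ltn ltnSn orbT.
rewrite addnA; apply: leq_trans (leq_addr _ _).
have -> : 'C(m.*2.+1, m.+1) = 'C(m.*2.+1, m).
  rewrite -bin_sub; last by rewrite -addnn; lia.
  by congr 'C(_, _); rewrite -addnn; lia.
by rewrite mul2n addnn.
Qed.

Lemma prime_dvd_fact (p n : nat) : prime p -> (p %| n`!)%N -> (p <= n)%N.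
Proof.
move=> pp; elim: n => [|n IH]; first by rewrite fact0 Euclid_dvd1.
rewrite factS Euclid_dvdM // => /orP[/dvdn_leq -> //|/IH/leq_trans]; exact.
Qed.

(** Erdos's argument: an even n > 2 is not prime, and for n = 2m+1 the primes in ]m+1, 2m+1] all
    divide the binomial coefficient C(2m+1, m), as they divide (2m+1)! but neither m! nor (m+1)!. *)
Lemma primorial_le (n : nat) : (primorial n <= 4 ^ n)%N.
Proof.
elim/ltn_ind: n => n IH.
case: n IH => [|[|[|n]]] IH.
- by rewrite /primorial big_geq.
- by rewrite /primorial big_nat_cond big_pred0 // => p; case: p => [|[|p]].
- by rewrite primorialS primorialS /primorial big_geq.
case: (boolP (odd n.+3)) => odd_n; last first.
  rewrite primorialS ifF ?muln1.
    by apply: leq_trans (IH _ (ltnSn _)) _; rewrite leq_exp2l.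
  apply/negP => pn; have [//|] := even_prime pn.
  by rewrite (negbTE odd_n).
have [m em] : exists m, n.+3 = m.*2.+1.
  by exists n.+2./2; rewrite -[LHS]odd_double_half odd_n /= uphalf_half; lia.
have m_gt0 : (0 < m)%N by case: (m) em.
rewrite em /primorial (@big_cat_nat _ _ _ m.+2) //=; last by rewrite -addnn;
  lia.
have -> : (4 ^ m.*2.+1 = 4 ^ m.+1 * 4 ^ m)%N by rewrite -expnD -addnn addSn.
apply: leq_mul; first by apply: IH; rewrite em -addnn; lia.
apply: leq_trans (bin_middle_le m).
apply: dvdn_leq; first by rewrite bin_gt0 -addnn; lia.
apply: prime_prod_dvd => p pp /andP[p1 p2].
have m_le : (m <= m.*2.+1)%N by rewrite -addnn; lia.
have : (p %| m.*2.+1`!)%N by rewrite dvdn_fact // prime_gt0.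
rewrite -(bin_fact m_le) !Euclid_dvdM // => /orP[//|/orP[]].
  by move/(prime_dvd_fact pp); lia.
by move/(prime_dvd_fact pp); rewrite -addnn in p2 *; lia.
Qed.

End Primorial.

(** * The ratio of n to its totient at primorials *)

Section TotientRatio.
Variable R : realType.

Lemma totient_primorial (n : nat) :
  totient (primorial n) = (\prod_(1 <= p < n.+1 | prime p) p.-1)%N.
Proof.
elim: n => [|n IH]; first by rewrite /primorial !big_geq.
rewrite big_mkcond big_nat_recr //= -big_mkcond /= -IH primorialS.
case: ifP => np; last by rewrite !muln1.
have co : coprime (primorial n) n.+1 by exact: coprime_prime_prod.
by rewrite (totient_coprime co) (totient_prime np).
Qed.

Lemma primorial_totient (n : nat) :
  (primorial n)%:R = (totient (primorial n))%:R * expR (log_euler_prod R n).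
Proof.
rewrite totient_primorial /primorial /log_euler_prod expR_sum !natr_prod.
rewrite -big_split /=; apply: eq_bigr => p pp.
have p0 : 0 < p%:R :> R by rewrite ltr0n prime_gt0.
have /andP[_ p1] := @inv_prime_bounds R p pp.
rewrite expRN lnK ?posrE ?subr_gt0 // -subn1 natrB ?prime_gt0 //.
have p2 : p%:R - 1 != 0 :> R by rewrite subr_eq0 pnatr_eq1 neq_ltn prime_gt1 //
  orbT.
by field; rewrite p2 gt_eqF.
Qed.

Lemma ln2_le1 : ln 2 <= 1 :> R.
Proof. by have := @le_ln1Dx R 1; apply; rewrite (lt_trans (ltrN10 _)). Qed.

(** The totient is at most 4^N with N <= e^k, and ln 4 <= 2 <= e. *)
Lemma lnln_totient_primorial_le (k : nat) :
  ln (ln (totient (primorial (expR_nat R k)))%:R) <= k%:R + 1 :> R.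
Proof.
set N := expR_nat R k; set g := totient _.
have Nk : N%:R <= expR k%:R :> R by rewrite /N truncn_le expR_ge0.
have g0 : 0 < g%:R :> R by rewrite ltr0n totient_gt0 primorial_gt0.
have lg : ln g%:R <= expR (k%:R + 1) :> R.
  apply: le_trans (_ : ln (4 ^ N)%:R <= _).
    rewrite ler_ln ?posrE // ?ltr0n ?expn_gt0 // ler_nat.
    apply: leq_trans (primorial_le N).
    by rewrite /g totient_primorial; apply: leq_prod => p _; exact: leq_pred.
  rewrite natrX lnXn // -[X in X <= _]mulr_natl expRD.
  apply: ler_pM => //; first by rewrite ln_ge0 // ler1n.
  have -> : 4 = 2 ^+ 2 :> R by rewrite -natrX.
  rewrite lnXn // -[X in X <= _]mulr_natl.
  have := ln2_le1; have := expR_ge1Dx (1 : R); lra.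
have [l0|l0] := leP (ln g%:R : R) 0; first by rewrite ln0 // addr_ge0.
by rewrite -[X in _ <= X]expRK ler_ln ?posrE // expR_gt0.
Qed.

Theorem totient_ratio_frequently (B : nat) : exists n : nat,
  [/\ (0 < n)%N, (B <= totient n)%N &
   expR (euler_gamma R) * (totient n)%:R * ln (ln (totient n)%:R)
     - 3 * expR (euler_gamma R) * (totient n)%:R <= n%:R].
Proof.
(* As p <= k <= e^k, this prime divides the primorial, so that p - 1 >= B divides the totient. *)
have [p pB pp] := prime_above B.
have [k [pk k0 Hk]] := mertens_frequently R p.
exists (primorial (expR_nat R k)); split.
- exact: primorial_gt0.
- apply: leq_trans (_ : p.-1 <= _)%N; first by case: (p) pB.
  have pN : (p < (expR_nat R k).+1)%N.
    rewrite ltnS /expR_nat truncn_ge_nat ?expR_ge0 //.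
    apply: le_trans (_ : k%:R <= _); first by rewrite ler_nat.
    by apply: le_trans (expR_ge1Dx _); rewrite lerDr.
  apply: dvdn_leq; first by rewrite totient_gt0 primorial_gt0.
  rewrite totient_primorial big_mkcond (bigD1_seq p) ?iota_uniq //=.
    by rewrite pp dvdn_mulr.
  by rewrite mem_index_iota prime_gt0.
rewrite primorial_totient; set g : R := (totient _)%:R.
have g0 : 0 <= g by rewrite ler0n.
have lk := lnln_totient_primorial_le k; rewrite -/g in lk.
set l := ln (ln g) in lk *; set e := expR (euler_gamma R).
have e0 : 0 < e by exact: expR_gt0.
suff h : e * (k%:R - 2) <= expR (log_euler_prod R (expR_nat R k)).
  have : g * (e * (k%:R - 2)) <= g * expR (log_euler_prod R (expR_nat R k)).
    by rewrite ler_wpM2l.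
  apply: le_trans.
  have : g * e * (l - 3) <= g * e * (k%:R - 2).
    by rewrite ler_wpM2l ?mulr_ge0 ?(ltW e0) //; lra.
  lra.
apply: le_trans (_ : expR (ln k%:R + euler_gamma R - 2 / k%:R) <= _); last
  first.
  by rewrite ler_expR ltW.
have kR : 0 < k%:R :> R by rewrite ltr0n.
rewrite expRD expRD lnK ?posrE // -/e.
have : 1 - 2 / k%:R <= expR (- (2 / k%:R)) :> R by exact: expR_ge1Dx.
move=> h; have : k%:R * e * (1 - 2 / k%:R) <= k%:R * e * expR (- (2 / k%:R)).
  by rewrite ler_wpM2l // mulr_ge0 ?ltW.
apply: le_trans; rewrite le_eqVlt; apply/orP; left; apply/eqP.
by field; rewrite gt_eqF.
Qed.

End TotientRatio.

(** * Cyclotomic companion matrices *)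

Section CyclotomicMatrix.

(** The matrix is hidden behind two properties so that its size can later be rewritten into
    [totient n]. *)
Lemma companionmx_shift (p : {poly int}) : p \is monic ->
  exists C : 'M[int]_((size p).-1), char_poly C = p /\
    forall i j : 'I_(size p).-1, (i.+1 < (size p).-1)%N ->
      C i j = (i.+1 == j :> nat)%:R.
Proof.
move=> pm; exists (companionmx p); split; first exact: companionmxK.
move=> i j ij; rewrite !mxE ifF //.
by apply/negbTE; rewrite neq_ltn -ltnS prednK ?(leq_trans _ ij) // ltnS.
Qed.

(** Over the rationals f is coprime to Phi_n, the minimal polynomial of z. A Bezout relation
    evaluated at C, where Phi_n vanishes by Cayley-Hamilton, inverts f(C). *)
Lemma det_horner_mx_Cyclotomic (n d : nat) (C : 'M[int]_d.+1) (f : {poly int})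
    (z : algC) :
  n.-primitive_root z -> char_poly C = 'Phi_n ->
  ~~ root (map_poly intr f) z -> \det (horner_mx C f) != 0.
Proof.
move=> z_prim charC fz.
pose QC : 'M[rat]_d.+1 := map_mx intr C.
pose fQ : {poly rat} := map_poly intr f.
have intrC (q : {poly int}) :
    map_poly (ratr : rat -> algC) (map_poly intr q) = map_poly intr q.
  by rewrite -map_poly_comp; apply: eq_map_poly => b; rewrite /= rmorph_int.
have [q [q_min q_monic q_root]] := minCpolyP z.
have qE : q = map_poly intr 'Phi_n.
  apply: (map_poly_inj (ratr : {rmorphism rat -> algC})).
  by rewrite -q_min intrC (minCpoly_cyclotomic z_prim) (Cintr_Cyclotomic
    z_prim).
have q0 : q != 0 by exact: monic_neq0.
(* If z is not a root of the gcd, it is a root of the cofactor, which q then divides; comparing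
   degrees, the gcd is constant. *)
have cop : coprimep fQ q.
  rewrite /coprimep.
  have /dvdpP[h hE] : gcdp fQ q %| q by exact: dvdp_gcdr.
  have g0 : gcdp fQ q != 0 by rewrite gcdp_eq0 negb_and q0 orbT.
  have h0 : h != 0 by apply: contraNneq q0 => h0; rewrite hE h0 mul0r.
  have : root (map_poly ratr q) z by rewrite q_root.
  rewrite {1}hE rmorphM rootM => /orP[hz|gz].
    rewrite q_root in hz; have := dvdp_leq h0 hz.
    rewrite {1}hE size_mul // => hs.
    have hs0 : (0 < size h)%N by rewrite size_poly_gt0.
    have gs0 : (0 < size (gcdp fQ q))%N by rewrite size_poly_gt0.
    by move: (size h) (size (gcdp _ _)) hs hs0 gs0 => a b; lia.
  case/negP: fz; rewrite -intrC q_root -/fQ.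
  rewrite q_root in gz; apply: dvdp_trans gz _; exact: dvdp_gcdl.
have hq : horner_mx QC q = 0.
  by rewrite qE -charC map_char_poly Cayley_Hamilton.
have /Bezout_coprimepP[[u v] /= /eqpP[[c1 c2] /andP[c1_0 c2_0] e]] := cop.
have eM : c1 *: (horner_mx QC u *m horner_mx QC fQ) = c2%:M.
  have := congr1 (horner_mx QC) e.
  rewrite !linearZ /= rmorphD !rmorphM /= hq mulr0 addr0 rmorph1 => ->.
  by rewrite -scalemx1.
have : \det (horner_mx QC fQ) != 0.
  apply: contraTneq c2_0 => d0; rewrite negbK.
  have := congr1 determinant eM.
  rewrite detZ det_mulmx d0 !mulr0 det_scalar => /esym/eqP.
  by rewrite expf_eq0 => /andP[].
rewrite /QC /fQ -map_horner_mx det_map_mx; apply: contraNneq => ->.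
by rewrite rmorph0.
Qed.

(** The second and third clauses hold because X^j - 1 and non-zero polynomials of degree below
    phi(n) do not vanish at a primitive n-th root of unity. For the last, e_0 C^k = e_k, so row k of
    C^i is e_0 C^(k+i), symmetric in i and k; Hankel matrices inherit their symmetry from this. *)
Lemma cyclotomic_mx (n : nat) : (0 < n)%N ->
  exists C : 'M[int]_(totient n),
  [/\ C ^+ n = 1,
      forall j (x : 'rV_(totient n)), (0 < j < n)%N -> x *m C ^+ j = x -> x = 0,
      forall x : 'rV_(totient n), x != 0 -> \det (\sum_i x 0 i *: C ^+ i) != 0 &
      forall i j : 'I_(totient n), row j (C ^+ i) = row i (C ^+ j)].
Proof.
move=> n0.
have [C [charC Cshift]] := companionmx_shift (Cyclotomic_monic n).
have sz := size_Cyclotomic n.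
have dE : (size 'Phi_n).-1 = totient n by rewrite sz.
move: C charC Cshift; rewrite dE.
have : (0 < totient n)%N by rewrite totient_gt0.
move: sz; case: (totient n) => // d sz _ C charC Cshift; exists C.
have [z z_prim] := C_prim_root_exists n0.
have det_nz f : ~~ root (map_poly intr f : {poly algC}) z ->
    \det (horner_mx C f) != 0.
  exact: det_horner_mx_Cyclotomic z_prim charC.
have Cn : C ^+ n = 1.
  have := prod_Cyclotomic n0.
  have nd : n \in divisors n by rewrite -dvdn_divisors.
  rewrite (big_rem _ nd) /= => /(congr1 (horner_mx C)).
  rewrite rmorphM rmorphB rmorphXn /= horner_mx_X rmorph1 -charC.
  by rewrite Cayley_Hamilton mul0r => /esym/eqP; rewrite subr_eq0 => /eqP.
have inj (M : 'M[int]_d.+1) (x : 'rV_d.+1) : \det M != 0 -> x *m M = 0 -> x = 0.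
  move=> M0 /(congr1 (mulmx^~ (\adj M))) /=.
  rewrite -mulmxA mul_mx_adj mul0mx mul_mx_scalar => /rowP e; apply/rowP => j.
  by move: (e j); rewrite !mxE => /eqP; rewrite mulf_eq0 (negbTE M0) => /eqP.
have row0 i (id : (i < d.+1)%N) : row ord0 (C ^+ i) = delta_mx 0 (Ordinal id).
  elim: i id => [|i IH] id.
    by rewrite expr0 rowE mulmx1; congr delta_mx; exact: val_inj.
  rewrite exprSr row_mul (IH (ltnW id)) -rowE.
  by apply/rowP => j; rewrite !mxE (Cshift (Ordinal (ltnW id))) // -val_eqE
    eq_sym.
split => //.
- move=> j x /andP[j0 jn] xj; apply: (inj (horner_mx C ('X^j - 1))); last first.
    by rewrite rmorphB rmorphXn /= horner_mx_X rmorph1 mulmxBr mulmx1 xj subrr.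
  apply: det_nz; rewrite rmorphB rmorph1 /= map_polyXn /root !hornerE.
  rewrite subr_eq0 -(prim_order_dvd z_prim) ; apply/negP => /(dvdn_leq j0).
  by rewrite leqNgt jn.
- move=> x x0.
  have -> : \sum_i x 0 i *: C ^+ i = horner_mx C (rVpoly x).
    rewrite /rVpoly poly_def rmorph_sum /=; apply: eq_bigr => i _.
    by rewrite linearZ /= rmorphXn /= horner_mx_X valK.
  apply: det_nz; apply/negP => rt.
  have [q [q_min q_monic q_root]] := minCpolyP z.
  have e : map_poly (ratr : rat -> algC) (map_poly intr (rVpoly x)) =
      map_poly intr (rVpoly x).
    by rewrite -map_poly_comp; apply: eq_map_poly => b; rewrite /= rmorph_int.
  move: rt; rewrite -e q_root => /dvdp_leq.
  have x0' : rVpoly x != 0.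
    by apply: contra_neq x0 => x0; rewrite -(rVpolyK x) x0 linear0.
  have -> : size q = d.+2.
    rewrite -sz -(size_map_poly (ratr : {rmorphism rat -> algC}) q) -q_min.
    rewrite (minCpoly_cyclotomic z_prim) -(Cintr_Cyclotomic z_prim).
    by rewrite size_map_inj_poly // => a b /eqP; rewrite eqr_int => /eqP.
  have inj_Q : injective (intr : int -> rat).
    by move=> a b /eqP; rewrite eqr_int => /eqP.
  rewrite map_poly_eq0_id0 ?intr_eq0 ?lead_coef_eq0 // => /(_ x0').
  rewrite size_map_inj_poly // ltnNge size_poly //.
- have e (i k : 'I_d.+1) : row k (C ^+ i) = row ord0 (C ^+ (k + i)).
    rewrite exprD row_mul (row0 _ (ltn_ord k)) -rowE; congr row; exact: val_inj.
  by move=> i j; rewrite !e addnC.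
Qed.

End CyclotomicMatrix.

(** * Lebesgue measure on C^g *)

Section LebesgueTuple.
Variable R : realType.

Local Notation cons2 n := (fun p : measurableTypeR R * n.-tuple R =>
  [tuple of (p.1 : R) :: p.2] : n.+1.-tuple R).

Lemma measurable_cons2 (n : nat) : measurable_fun setT (cons2 n).
Proof.
exact: (@measurable_cons _ _ _ R fst n snd measurable_fst measurable_snd).
Qed.

Lemma measurable_uncons (n : nat) : measurable_fun setT
  (fun t : n.+1.-tuple R => (thead t, [tuple of behead t]) :
     measurableTypeR R * n.-tuple R).
Proof.
apply/measurable_fun_pairP; split => /=; last exact: measurable_behead.
exact: (@measurable_tnth _ R n.+1 ord0).
Qed.

Lemma uncons_cons2 (n : nat) (p : R * n.-tuple R) :
  (thead [tuple of p.1 :: p.2], [tuple of behead [tuple of p.1 :: p.2]]) = p.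
Proof. by case: p => x t; rewrite theadE; congr pair; exact: val_inj. Qed.

(** [lebesgue_tuple] is a bare set function; measure theory applies once it is packed as a measure.
    Sigma-finiteness is carried through the induction because the next product requires it. *)
Lemma lebesgue_tuple_is_measure (n : nat) :
  exists nu : {sigma_finite_measure set (n.-tuple R) -> \bar R},
    (nu : set _ -> _) = @lebesgue_tuple R n.
Proof.
elim: n => [|n [nu nuE]].
  by exists (dirac [tuple] : {sigma_finite_measure set (0.-tuple R) -> \bar R}).
pose m := measure_function_pushforward__canonical__measure_function_Measure
  (product_measure1 (@lebesgue_measure R) nu) (@measurable_cons2 n).
have sf : sigma_finite setT m.
  have /sigma_finiteP[F [TF ndF Foo]] := sigma_finiteT (@lebesgue_measure R).
  have /sigma_finiteP[G [TG ndG Goo]] := sigma_finiteT nu.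
  exists (fun i => (fun t : n.+1.-tuple R =>
      (thead t, [tuple of behead t])) @^-1` (F i `*` G i)).
    rewrite -preimage_bigcup -[LHS](@preimage_setT _ _
      (fun t : n.+1.-tuple R => (thead t, [tuple of behead t]))).
    congr (_ @^-1` _); rewrite -setXTT TF TG predeqE => -[x y]; split.
      move=> [/= [i _ Fi] [k _ Gk]]; exists (maxn i k) => //; split.
      - by move: x Fi; exact/subsetPset/ndF/leq_maxl.
      - by move: y Gk; exact/subsetPset/ndG/leq_maxr.
    by move=> [i _ [/= ? ?]]; split; exists i.
  move=> i; have [mF Fi] := Foo i; have [mG Gi] := Goo i; split.
    rewrite -[X in measurable X]setTI; apply: measurable_uncons => //.
    exact: measurableX.
  rewrite [m _](_ : _ = product_measure1 (@lebesgue_measure R) nu (F i `*` G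
    i)).
    by rewrite product_measure1E // lte_mul_pinfty // ge0_fin_numE.
  rewrite /m /= /pushforward; congr (product_measure1 _ _ _).
  by apply/funext => p; exact: (congr1 (F i `*` G i) (uncons_cons2 p)).
pose ms : {sigma_finite_measure set (n.+1.-tuple R) -> \bar R} :=
  HB.pack (Measure.sort m) (Measure.class m) (Measure_isSigmaFinite.Build _ _ _
    m sf).
by exists ms; rewrite /= -nuE.
Qed.

Lemma measurable_affine (c d : R) :
  measurable_fun setT
    (fun x : measurableTypeR R => c * x + d : measurableTypeR R).
Proof. by apply: measurable_funD => //; exact: measurable_funM. Qed.

(** By uniqueness of Lebesgue measure: c times the image measure agrees with it on half-open
    intervals. *)
Lemma lebesgue_measure_affine (c d : R) (A : set R) : 0 < c ->
  measurable A ->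
  lebesgue_measure ((fun x : R => c * x + d) @^-1` A)
    = ((c^-1)%:E * lebesgue_measure A)%E.
Proof.
move=> c0 mA.
pose m := measure_function_pushforward__canonical__measure_function_Measure
  (@lebesgue_measure R) (measurable_affine c d).
have -> : lebesgue_measure A = mscale (NngNum (ltW c0)) m A.
  apply: lebesgue_measure_unique => // _ [[a b] _ <-] /=.
  rewrite /mscale /m /= /pushforward.
  have -> : (fun x : R => c * x + d) @^-1` `]a, b]
      = `](a - d) / c, (b - d) / c]%classic.
    apply/seteqP; split => x /=; rewrite !in_itv /=;
      by rewrite ltr_pdivrMr // ler_pdivlMr // ltrBlDr lerBrDr (mulrC x).
  rewrite !lebesgue_measure_itv /= !lte_fin ltr_pM2r ?invr_gt0 // ltrD2r.
  case: ifP => _; last by rewrite mule0.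
  rewrite -!EFinB -EFinM; congr EFin; field; exact: lt0r_neq0.
by rewrite /mscale /= muleA -EFinM mulVf ?lt0r_neq0 // mul1e.
Qed.

Lemma measurable_mktuple (n : nat) (f : 'I_n -> n.-tuple R -> R) :
  (forall i, measurable_fun setT (f i)) ->
  measurable_fun setT (fun t => [tuple f i t | i < n]).
Proof.
move=> mf; apply/measurable_fun_tnthP => i.
rewrite (_ : _ \o _ = f i) //; apply/funext => t /=.
by rewrite tnth_mktuple.
Qed.

(** Diagonal affine maps suffice: balls and tiles are only translated and rescaled, at separate
    rates in the real and imaginary directions. *)
Definition affine_tuple (n : nat) (c d : 'I_n -> R) (t : n.-tuple R) :
  n.-tuple R := [tuple c i * tnth t i + d i | i < n].

Lemma measurable_affine_tuple (n : nat) (c d : 'I_n -> R) :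
  measurable_fun setT (affine_tuple c d).
Proof.
apply: measurable_mktuple => i.
apply: measurable_funD => //; apply: measurable_funM => //.
exact: measurable_tnth.
Qed.

Lemma affine_tuple_cons (n : nat) (c d : 'I_n.+1 -> R) (x : R)
    (t : n.-tuple R) :
  affine_tuple c d [tuple of x :: t] = [tuple of (c ord0 * x + d ord0) ::
    affine_tuple (c \o lift ord0) (d \o lift ord0) t].
Proof.
apply: eq_from_tnth => i; rewrite tnth_mktuple.
case: (unliftP ord0 i) => [j|] ->; last by rewrite !tnth0.
by rewrite !tnthS tnth_mktuple.
Qed.

Lemma lebesgue_tuple_affine (n : nat) (c d : 'I_n -> R) (A : set (n.-tuple R)) :
  (forall i, 0 < c i) -> measurable A ->
  lebesgue_tuple (affine_tuple c d @^-1` A)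
    = ((\prod_i c i)^-1%:E * lebesgue_tuple A)%E.
Proof.
elim: n c d A => [|n IH] c d A c0 mA.
  rewrite big_ord0 invr1 mul1e; congr lebesgue_tuple.
  by apply/funext => t; rewrite /preimage /mkset; congr A; rewrite tuple0
    [RHS]tuple0.
have [nu nuE] := lebesgue_tuple_is_measure n.
pose mA' := (fun p : measurableTypeR R * n.-tuple R =>
  [tuple of (p.1 : R) :: p.2] : n.+1.-tuple R) @^-1` A.
have m_mA' : measurable mA'.
  by rewrite -[X in measurable X]setTI; exact: measurable_cons2.
rewrite /= /pushforward /product_measure1 -nuE.
pose h x := nu (xsection mA' x).
have mh : measurable_fun setT h by exact: measurable_fun_xsection.
pose c' := c \o lift ord0; pose d' := d \o lift ord0.
have P0 : 0 < \prod_i c' i by apply: prodr_gt0 => i _; exact: c0.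
transitivity (\int[@lebesgue_measure R]_x
   (((\prod_i c' i)^-1)%:E * h (c ord0 * x + d ord0)%R))%E.
  apply: eq_integral => x _ /=.
  rewrite nuE.
  rewrite (_ : xsection _ x = affine_tuple c' d' @^-1`
    (xsection mA' (c ord0 * x + d ord0)%R)).
    rewrite IH; [|by move=> i; exact: c0|exact: measurable_xsection].
    by rewrite /h nuE.
  apply/seteqP; split => t; rewrite /xsection /= !inE /mA' /preimage /mkset /=;
    by rewrite affine_tuple_cons.
have mhc : measurable_fun setT (fun x : measurableTypeR R => h (c ord0 * x + d
  ord0)%R).
  exact: measurableT_comp mh (measurable_affine _ _).
rewrite ge0_integralZl //; last by rewrite lee_fin invr_ge0 ltW.
rewrite big_ord_recl invfM EFinM -muleA [RHS]muleCA; congr (_ * _)%E.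
have := ge0_integral_pushforward (measurable_affine (c ord0) (d ord0))
  (@lebesgue_measure R) measurableT mh.
rewrite preimage_setT /comp => <-; last by [].
pose m := measure_function_pushforward__canonical__measure_function_Measure
  (@lebesgue_measure R) (measurable_affine (c ord0) (d ord0)).
have c0' : 0 <= (c ord0)^-1 by rewrite invr_ge0 ltW.
rewrite -(ge0_integral_mscale _ measurableT (NngNum c0') mh) //.
rewrite -[LHS]/(\int[m]_(x in setT) h x)%E.
apply: (@eq_measure_integral _ _ _ _ (mscale (NngNum c0') (@lebesgue_measure
  R)) m).
move=> B mB _; exact: (lebesgue_measure_affine (d ord0) (c0 ord0) mB).
Qed.

Lemma measurable_box (n : nat) (a b : R) :
  measurable [set t : n.-tuple R | forall i, a <= tnth t i < b].
Proof.
rewrite (_ : [set _ | _] = \bigcap_(i in [set: 'I_n])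
    (fun t : n.-tuple R => tnth t i) @^-1` `[a, b[%classic).
  apply: fin_bigcap_measurable => // i _.
  by rewrite -[X in measurable X]setTI; exact: measurable_tnth.
apply/seteqP; split => t /= H i; first by move=> _; rewrite /= in_itv /= H.
by have := H i Logic.I; rewrite /= in_itv.
Qed.

Lemma lebesgue_tuple_box (n : nat) :
  lebesgue_tuple [set t : n.-tuple R | forall i, 0 <= tnth t i < 1] = 1%E.
Proof.
elim: n => [|n IH].
  by rewrite /= diracE mem_set // => -[].
have [nu nuE] := lebesgue_tuple_is_measure n.
rewrite /= /pushforward -nuE.
rewrite (_ : _ @^-1` _ = `[0, 1[%classic `*`
    [set t : n.-tuple R | forall i, 0 <= tnth t i < 1]).
  rewrite product_measure1E //; last exact: measurable_box.
  rewrite nuE [X in (_ * X)%E]IH mule1 [LHS]lebesgue_measure_itv /= lte_fin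
    ltr01.
  by rewrite sube0.
apply/seteqP; split => -[x t] /=; rewrite in_itv /=.
  move=> H; split; first by have := H ord0; rewrite tnth0.
  by move=> i; have := H (lift ord0 i); rewrite tnthS.
move=> [H0 H] i; case: (unliftP ord0 i) => [j|] ->; last by rewrite tnth0.
by rewrite tnthS.
Qed.

End LebesgueTuple.

(** * Volumes in C^g under translations and rescalings *)

Section CgVolume.
Variables (R : realType) (g : nat).
Implicit Types (A B F : set 'rV[R[i]]_g) (z v : 'rV[R[i]]_g).

Definition Cg_measurable A := measurable (@tuple_to_Cg R g @^-1` A).

Definition re_row z : 'rV[R]_g := map_mx (@complex.Re R) z.
Definition im_row z : 'rV[R]_g := map_mx (@complex.Im R) z.
Definition complex_row (p w : 'rV[R]_g) : 'rV[R[i]]_g :=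
  \row_j (p 0 j +i* w 0 j)%C.

Lemma re_complex_row p w : re_row (complex_row p w) = p.
Proof. by apply/rowP => j; rewrite !mxE. Qed.

Lemma im_complex_row p w : im_row (complex_row p w) = w.
Proof. by apply/rowP => j; rewrite !mxE. Qed.

Lemma complex_row_eta z : complex_row (re_row z) (im_row z) = z.
Proof. by apply/rowP => j; rewrite !mxE; case: (z 0 j). Qed.

Lemma re_rowD z v : re_row (z + v) = re_row z + re_row v.
Proof. exact: (map_mxD (@complex.Re R)). Qed.

Lemma im_rowD z v : im_row (z + v) = im_row z + im_row v.
Proof. exact: (map_mxD (@complex.Im R)). Qed.

Lemma re_rowN z : re_row (- z) = - re_row z.
Proof. exact: (map_mxN (@complex.Re R)). Qed.

Lemma im_rowN z : im_row (- z) = - im_row z.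
Proof. exact: (map_mxN (@complex.Im R)). Qed.

Definition affine_Cg (a b : R) v z : 'rV[R[i]]_g :=
  complex_row (a *: re_row z) (b *: im_row z) + v.

Definition re_im_coef (a b : R) (i : 'I_(g + g)) : R :=
  match fintype.split i with inl _ => a | inr _ => b end.

Definition re_im_entry v (i : 'I_(g + g)) : R :=
  match fintype.split i with inl j => re_row v 0 j | inr j => im_row v 0 j end.

Lemma tuple_to_Cg_affine a b v (t : (g + g).-tuple R) :
  tuple_to_Cg (affine_tuple (re_im_coef a b) (re_im_entry v) t)
    = affine_Cg a b v (tuple_to_Cg t).
Proof.
apply/rowP => j; rewrite !mxE !tnth_mktuple /re_im_coef /re_im_entry.
have -> : fintype.split (lshift g j) = inl j by exact: (@unsplitK g g (inl j)).
have -> : fintype.split (rshift g j) = inr j by exact: (@unsplitK g g (inr j)).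
by rewrite !mxE /=; case: (v 0 j).
Qed.

Lemma prod_re_im_coef a b : \prod_i re_im_coef a b i = a ^+ g * b ^+ g.
Proof.
rewrite big_split_ord /=; congr (_ * _).
  rewrite (eq_bigr (fun=> a)) ?prodr_const ?card_ord // => j _.
  by rewrite /re_im_coef (@unsplitK g g (inl j)).
rewrite (eq_bigr (fun=> b)) ?prodr_const ?card_ord // => j _.
by rewrite /re_im_coef (@unsplitK g g (inr j)).
Qed.

Lemma preimage_affine_Cg a b v A :
  @tuple_to_Cg R g @^-1` (affine_Cg a b v @^-1` A) =
  affine_tuple (re_im_coef a b) (re_im_entry v) @^-1` (@tuple_to_Cg R g @^-1`
    A).
Proof.
apply/seteqP; split => t; rewrite /preimage /mkset.
  by rewrite tuple_to_Cg_affine.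
by rewrite -tuple_to_Cg_affine.
Qed.

Lemma Cg_measurable_affine a b v A :
  Cg_measurable A -> Cg_measurable (affine_Cg a b v @^-1` A).
Proof.
move=> mA; rewrite /Cg_measurable preimage_affine_Cg -[X in measurable X]setTI.
exact: measurable_affine_tuple.
Qed.

Lemma Cg_volume_affine a b v A : 0 < a -> 0 < b -> Cg_measurable A ->
  Cg_volume (affine_Cg a b v @^-1` A)
    = (((a * b) ^+ g)^-1%:E * Cg_volume A)%E.
Proof.
move=> a0 b0 mA; rewrite /Cg_volume preimage_affine_Cg lebesgue_tuple_affine //.
  by rewrite prod_re_im_coef exprMn.
by move=> i; rewrite /re_im_coef; case: fintype.split.
Qed.

Lemma affine_CgE z v : affine_Cg 1 1 v z = z + v.
Proof. by rewrite /affine_Cg !scale1r complex_row_eta. Qed.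

Lemma Cg_measurable_translate v A :
  Cg_measurable A -> Cg_measurable [set z | A (z - v)].
Proof.
move=> mA; have := Cg_measurable_affine 1 1 (- v) mA.
congr Cg_measurable; apply/seteqP; split => z;
  by rewrite /preimage /mkset affine_CgE.
Qed.

Lemma Cg_volume_translate v A : Cg_measurable A ->
  Cg_volume [set z | A (z - v)] = Cg_volume A.
Proof.
move=> mA; have := Cg_volume_affine (- v) ltr01 ltr01 mA.
rewrite mulr1 expr1n invr1 mul1e => <-; congr Cg_volume.
by apply/seteqP; split => z; rewrite /preimage /mkset affine_CgE.
Qed.

Lemma Cg_volume_set0 : Cg_volume (@set0 'rV[R[i]]_g) = 0%E.
Proof.
have [nu nuE] := lebesgue_tuple_is_measure R (g + g).
by rewrite /Cg_volume preimage_set0 -nuE measure0.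
Qed.

Lemma Cg_volume_ge0 A : (0 <= Cg_volume A)%E.
Proof.
have [nu nuE] := lebesgue_tuple_is_measure R (g + g).
by rewrite /Cg_volume -nuE measure_ge0.
Qed.

Lemma le_Cg_volume A B : Cg_measurable A -> Cg_measurable B ->
  A `<=` B -> (Cg_volume A <= Cg_volume B)%E.
Proof.
move=> mA mB AB; have [nu nuE] := lebesgue_tuple_is_measure R (g + g).
by rewrite /Cg_volume -nuE le_measure // ?inE //; exact: preimage_subset.
Qed.

Lemma Cg_measurable_bigU (I : eqType) (s : seq I) (F : I -> set 'rV[R[i]]_g) :
  (forall i, i \in s -> Cg_measurable (F i)) ->
  Cg_measurable [set z | exists2 i, i \in s & F i z].
Proof.
elim: s => [|j s IH] mF.
  rewrite (_ : [set _ | _] = set0).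
    by rewrite /Cg_measurable preimage_set0; exact: measurable0.
  by apply/seteqP; split => z //= [].
rewrite (_ : [set _ | _] = F j `|` [set z | exists2 i, i \in s & F i z]).
  rewrite /Cg_measurable preimage_setU; apply: measurableU.
    by apply: mF; rewrite mem_head.
  by apply: IH => i si; apply: mF; rewrite in_cons si orbT.
apply/seteqP; split => z /=.
  move=> [k]; rewrite in_cons => /orP[/eqP ->|sk] Fz; first by left.
  by right; exists k.
move=> [Fz|[i si Fz]]; first by exists j; rewrite ?mem_head.
by exists i; rewrite // in_cons si orbT.
Qed.

Lemma Cg_volume_bigU_le (I : eqType) (s : seq I) (F : I -> set 'rV[R[i]]_g) :
  (forall i, i \in s -> Cg_measurable (F i)) ->
  (Cg_volume [set z | exists2 i, i \in s & F i z]
    <= \sum_(i <- s) Cg_volume (F i))%E.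
Proof.
have [nu nuE] := lebesgue_tuple_is_measure R (g + g).
elim: s => [|j s IH] mF.
  rewrite big_nil (_ : [set _ | _] = set0) ?Cg_volume_set0 //.
  by apply/seteqP; split => z //= [].
rewrite big_cons; have mF' i : i \in s -> Cg_measurable (F i).
  by move=> si; apply: mF; rewrite in_cons si orbT.
apply: le_trans (leeD2l _ (IH mF')).
rewrite (_ : [set _ | _] = F j `|` [set z | exists2 i, i \in s & F i z]).
  rewrite /Cg_volume preimage_setU -nuE; apply: measureU2.
    by apply: mF; rewrite mem_head.
  exact: Cg_measurable_bigU mF'.
apply/seteqP; split => z /=.
  move=> [k]; rewrite in_cons => /orP[/eqP ->|sk] Fz; first by left.
  by right; exists k.
move=> [Fz|[i si Fz]]; first by exists j; rewrite ?mem_head.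
by exists i; rewrite // in_cons si orbT.
Qed.

Lemma Cg_volume_bigU (I : eqType) (s : seq I) (F : I -> set 'rV[R[i]]_g) :
  uniq s -> (forall i, i \in s -> Cg_measurable (F i)) ->
  (forall i j z, i \in s -> j \in s -> F i z -> F j z -> i = j) ->
  Cg_volume [set z | exists2 i, i \in s & F i z]
    = (\sum_(i <- s) Cg_volume (F i))%E.
Proof.
have [nu nuE] := lebesgue_tuple_is_measure R (g + g).
elim: s => [|j s IH] /=.
  move=> _ _ _; rewrite big_nil (_ : [set _ | _] = set0) ?Cg_volume_set0 //.
  by apply/seteqP; split => z //= [].
move=> /andP[js us] mF dF.
have mF' i : i \in s -> Cg_measurable (F i).
  by move=> si; apply: mF; rewrite in_cons si orbT.
rewrite big_cons -IH //; last first.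
  by move=> i k z si sk; apply: dF; rewrite in_cons ?si ?sk orbT.
rewrite (_ : [set _ | _] = F j `|` [set z | exists2 i, i \in s & F i z]).
  rewrite /Cg_volume preimage_setU -nuE measureU //.
  - by apply: mF; rewrite mem_head.
  - exact: Cg_measurable_bigU mF'.
  apply/seteqP; split => t //= [Fj [i si Fi]].
  have := dF j i _ (mem_head _ _) _ Fj Fi.
  by rewrite in_cons si orbT => /(_ isT) ji; move: js; rewrite ji si.
apply/seteqP; split => z /=.
  move=> [k]; rewrite in_cons => /orP[/eqP ->|sk] Fz; first by left.
  by right; exists k.
move=> [Fz|[i si Fz]]; first by exists j; rewrite ?mem_head.
by exists i; rewrite // in_cons si orbT.
Qed.

Definition cube (v : 'rV[R[i]]_g) (e : R) : set 'rV[R[i]]_g :=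
  [set z | forall j,
    0 <= re_row (z - v) 0 j < e /\ 0 <= im_row (z - v) 0 j < e].

Lemma unit_cubeE : @tuple_to_Cg R g @^-1` cube 0 1 =
  [set t : (g + g).-tuple R | forall i, 0 <= tnth t i < 1].
Proof.
apply/seteqP; split => t /= H.
  move=> i; case: (splitP i) => j ij.
    have -> : i = lshift g j by exact: val_inj.
    by have [+ _] := H j; rewrite subr0 !mxE.
  have -> : i = rshift g j by exact: val_inj.
  by have [_] := H j; rewrite subr0 !mxE.
by move=> j; rewrite subr0 !mxE /= !H.
Qed.

Lemma cubeE v e : 0 < e ->
  cube v e = affine_Cg e^-1 e^-1 (- (e^-1)%:C%C *: v) @^-1` cube 0 1.
Proof.
move=> e0; have h a : (0 <= e^-1 * a < 1) = (0 <= a < e).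
  by rewrite pmulr_rge0 ?invr_gt0 // ltr_pdivrMl // mulr1.
have E z : affine_Cg e^-1 e^-1 (- (e^-1)%:C%C *: v) z =
    complex_row (e^-1 *: re_row (z - v)) (e^-1 *: im_row (z - v)).
  apply/rowP => j; rewrite !mxE; case: (z 0 j) (v 0 j) => [a b] [c d] /=.
  by apply/eqP; rewrite eq_complex /=; apply/andP; split; apply/eqP; ring.
apply/seteqP; split => z /= H j; have := H j; rewrite E !subr0;
  by rewrite re_complex_row im_complex_row !mxE !h.
Qed.

Lemma Cg_measurable_cube v e : 0 < e -> Cg_measurable (cube v e).
Proof.
move=> e0; rewrite cubeE //; apply: Cg_measurable_affine.
by rewrite /Cg_measurable unit_cubeE; exact: measurable_box.
Qed.

Lemma Cg_volume_cube v e : 0 < e -> Cg_volume (cube v e) = (e ^+ (g + g))%:E.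
Proof.
move=> e0; rewrite cubeE // Cg_volume_affine ?invr_gt0 //.
  have -> : Cg_volume (cube 0 1) = 1%E.
    by rewrite /Cg_volume unit_cubeE; exact: lebesgue_tuple_box.
  by rewrite mule1 -invfM exprVn invrK exprMn -exprD.
by rewrite /Cg_measurable unit_cubeE; exact: measurable_box.
Qed.

End CgVolume.

(** * Hermitian norms and lattice point counts *)

Section BilinearForm.
Variables (R : realType) (g : nat).
Implicit Types (p w : 'rV[R]_g) (z : 'rV[R[i]]_g).

Definition bilin (S : 'M[R]_g) p w : R := (p *m S *m w^T) 0 0.

Lemma bilinDl S p p' w : bilin S (p + p') w = bilin S p w + bilin S p' w.
Proof. by rewrite /bilin !mulmxDl mxE. Qed.

Lemma bilinDr S p w w' : bilin S p (w + w') = bilin S p w + bilin S p w'.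
Proof. by rewrite /bilin linearD mulmxDr mxE. Qed.

Lemma bilinZl S a p w : bilin S (a *: p) w = a * bilin S p w.
Proof. by rewrite /bilin -!scalemxAl mxE. Qed.

Lemma bilinZr S a p w : bilin S p (a *: w) = a * bilin S p w.
Proof. by rewrite /bilin linearZ -scalemxAr mxE. Qed.

Lemma bilinNl S p w : bilin S (- p) w = - bilin S p w.
Proof. by rewrite -scaleN1r bilinZl mulN1r. Qed.

Lemma bilinNr S p w : bilin S p (- w) = - bilin S p w.
Proof. by rewrite -scaleN1r bilinZr mulN1r. Qed.

Lemma bilin_scale S a p w : bilin (a *: S) p w = a * bilin S p w.
Proof. by rewrite /bilin -scalemxAr -scalemxAl mxE. Qed.

Lemma bilinC S p w : S^T = S -> bilin S p w = bilin S w p.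
Proof.
move=> SS; have -> : bilin S p w = (p *m S *m w^T)^T 0 0 by rewrite mxE.
by rewrite !trmx_mul trmxK SS mulmxA.
Qed.

Lemma bilinE S p w : bilin S p w = \sum_i \sum_j p 0 i * S i j * w 0 j.
Proof.
rewrite /bilin mxE exchange_big; apply: eq_bigr => j _.
by rewrite mxE mulr_suml; apply: eq_bigr => i _; rewrite !mxE.
Qed.

Definition quad (S : 'M[R]_g) z : R :=
  bilin S (re_row z) (re_row z) + bilin S (im_row z) (im_row z).

Definition qnorm (S : 'M[R]_g) z : R := Num.sqrt (quad S z).

Definition mx_abs (S : 'M[R]_g) : R := \sum_i \sum_j `|S i j|.

Lemma bilin_le S p w a b :
  (forall j, `|p 0 j| <= a) -> (forall j, `|w 0 j| <= b) ->
  `|bilin S p w| <= a * b * mx_abs S.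
Proof.
move=> pa wb; rewrite bilinE /mx_abs mulr_sumr.
apply: le_trans (ler_norm_sum _ _ _) _; apply: ler_sum => i _.
rewrite mulr_sumr; apply: le_trans (ler_norm_sum _ _ _) _; apply: ler_sum => j
  _.
rewrite !normrM mulrAC; apply: ler_wpM2r => //.
by apply: ler_pM.
Qed.

Lemma quad_scale S a z : quad (a *: S) z = a * quad S z.
Proof. by rewrite /quad !bilin_scale mulrDr. Qed.

Section Coercive.
Variables (S : 'M[R]_g) (e : R).
Hypothesis S_sym : S^T = S.
Hypothesis e_gt0 : 0 < e.
Hypothesis S_coercive : forall p, e * \sum_j p 0 j ^+ 2 <= bilin S p p.

Lemma sum_sqr_ge0 p : 0 <= \sum_j p 0 j ^+ 2.
Proof. by apply: sumr_ge0 => j _; exact: sqr_ge0. Qed.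

Lemma bilin_ge0 p : 0 <= bilin S p p.
Proof.
by apply: le_trans (S_coercive p); rewrite mulr_ge0 ?sum_sqr_ge0 // ltW.
Qed.

Lemma entry_sqr_le p j : e * p 0 j ^+ 2 <= bilin S p p.
Proof.
apply: le_trans (S_coercive p); rewrite ler_pM2l // (bigD1 j) //= lerDl.
by apply: sumr_ge0 => k _; exact: sqr_ge0.
Qed.

Lemma bilin_eq0 p : bilin S p p = 0 -> p = 0.
Proof.
move=> p0; apply/rowP => j; rewrite mxE; apply/eqP.
have := entry_sqr_le p j; rewrite p0 pmulr_rle0 // => h.
by rewrite -sqrf_eq0 eq_le h sqr_ge0.
Qed.

Lemma quad_ge0 z : 0 <= quad S z.
Proof. by rewrite addr_ge0 ?bilin_ge0. Qed.

Lemma quad_eq0 z : quad S z = 0 -> z = 0.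
Proof.
have h1 := bilin_ge0 (re_row z); have h2 := bilin_ge0 (im_row z).
rewrite /quad => h; rewrite -(complex_row_eta z).
have -> : re_row z = 0 by apply: bilin_eq0; lra.
have -> : im_row z = 0 by apply: bilin_eq0; lra.
by apply/rowP => j; rewrite !mxE.
Qed.

Lemma quad_gt0 z : z != 0 -> 0 < quad S z.
Proof.
move=> z0; rewrite lt_neqAle quad_ge0 andbT eq_sym.
by apply: contra_neq z0; exact: quad_eq0.
Qed.

Definition bilin_Cg z z' : R :=
  bilin S (re_row z) (re_row z') + bilin S (im_row z) (im_row z').

Lemma quad_lin (a b : R) z z' :
  quad S (complex_row (a *: re_row z + b *: re_row z') (a *: im_row z + b *:
    im_row z'))
    = a ^+ 2 * quad S z + 2 * (a * b) * bilin_Cg z z' + b ^+ 2 * quad S z'.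
Proof.
rewrite /quad /bilin_Cg re_complex_row im_complex_row.
rewrite !(bilinDl, bilinDr, bilinZl, bilinZr).
rewrite (bilinC (re_row z') (re_row z)) // (bilinC (im_row z') (im_row z)) //.
by ring.
Qed.

Lemma bilin_Cg_CauchySchwarz z z' :
  bilin_Cg z z' ^+ 2 <= quad S z * quad S z'.
Proof.
have [z0|z'_neq0] := eqVneq z' 0.
  rewrite z0 /bilin_Cg /quad.
  have -> : re_row 0 = 0 *: re_row (0 : 'rV[R[i]]_g).
    by apply/rowP => j; rewrite !mxE /= mul0r.
  have -> : im_row 0 = 0 *: im_row (0 : 'rV[R[i]]_g).
    by apply/rowP => j; rewrite !mxE /= mul0r.
  by rewrite !bilinZr !mul0r !addr0 expr0n mulr0.
have q0 := quad_gt0 z'_neq0.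
have := quad_ge0 (complex_row
  (quad S z' *: re_row z + (- bilin_Cg z z') *: re_row z')
  (quad S z' *: im_row z + (- bilin_Cg z z') *: im_row z')).
rewrite quad_lin.
have -> : quad S z' ^+ 2 * quad S z
    + 2 * (quad S z' * - bilin_Cg z z') * bilin_Cg z z'
    + (- bilin_Cg z z') ^+ 2 * quad S z'
  = quad S z' * (quad S z * quad S z' - bilin_Cg z z' ^+ 2) by ring.
by rewrite pmulr_rge0 // subr_ge0.
Qed.

Lemma qnorm_ge0 z : 0 <= qnorm S z.
Proof. exact: sqrtr_ge0. Qed.

Lemma sqr_qnorm z : qnorm S z ^+ 2 = quad S z.
Proof. by rewrite sqr_sqrtr // quad_ge0. Qed.

Lemma qnormD z z' : qnorm S (z + z') <= qnorm S z + qnorm S z'.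
Proof.
rewrite -(@ler_pXn2r _ 2) ?nnegrE ?addr_ge0 ?qnorm_ge0 //.
rewrite sqrrD !sqr_qnorm.
have -> : quad S (z + z') = quad S z + 2 * bilin_Cg z z' + quad S z'.
  have := quad_lin 1 1 z z'.
  rewrite !scale1r -re_rowD -im_rowD complex_row_eta => ->; ring.
rewrite lerD2r lerD2l -[X in _ <= X]mulr_natl ler_pM2l //.
apply: le_trans (ler_norm _) _.
rewrite -(@ler_pXn2r _ 2) ?nnegrE ?mulr_ge0 ?qnorm_ge0 //.
by rewrite real_normK ?num_real // exprMn !sqr_qnorm bilin_Cg_CauchySchwarz.
Qed.

Lemma quadN z : quad S (- z) = quad S z.
Proof.
by rewrite /quad re_rowN im_rowN !bilinNl !bilinNr !opprK.
Qed.

Lemma qnormN z : qnorm S (- z) = qnorm S z.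
Proof. by rewrite /qnorm quadN. Qed.

Lemma qnorm_lt z r : 0 < r -> (qnorm S z < r) = (quad S z < r ^+ 2).
Proof.
by move=> r0; rewrite -sqr_qnorm ltr_pXn2r // ?nnegrE ?qnorm_ge0 // ltW.
Qed.

Definition qball (r : R) : set 'rV[R[i]]_g := [set z | qnorm S z < r].

Lemma measurable_bilin (f : (g + g).-tuple R -> 'rV[R]_g) :
  (forall j, measurable_fun setT (fun t => f t 0 j)) ->
  measurable_fun setT (fun t => bilin S (f t) (f t)).
Proof.
move=> mf; under eq_fun do rewrite bilinE.
apply: measurable_sum => i; apply: measurable_sum => j.
by apply: measurable_funM => //; apply: measurable_funM.
Qed.

Lemma Cg_measurable_qball r : Cg_measurable (qball r).
Proof.
have [r0|r0] := leP r 0.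
  rewrite (_ : qball r = set0).
    by rewrite /Cg_measurable preimage_set0; exact: measurable0.
  apply/seteqP; split => z //=; rewrite /qball /= => h.
  by have := le_lt_trans (qnorm_ge0 z) h; rewrite ltNge r0.
pose f (t : (g + g).-tuple R) := quad S (tuple_to_Cg t).
have mf : measurable_fun setT f.
  apply: measurable_funD; apply: measurable_bilin => j.
    rewrite (_ : (fun _ => _) = fun t => tnth t (lshift g j)).
      exact: measurable_tnth.
    by apply/funext => t; rewrite !mxE.
  rewrite (_ : (fun _ => _) = fun t => tnth t (rshift g j)).
    exact: measurable_tnth.
  by apply/funext => t; rewrite !mxE.
have := mf measurableT `]-oo, (r ^+ 2)[%classic (measurable_itv _).
rewrite setTI /Cg_measurable; congr measurable.
by apply/seteqP; split => t; rewrite /preimage /mkset /qball /= in_itv /=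
  qnorm_lt.
Qed.

Lemma qballE r : 0 < r -> qball r = affine_Cg r^-1 r^-1 0 @^-1` qball 1.
Proof.
move=> r0; have E z : quad S (affine_Cg r^-1 r^-1 0 z) = (r ^+ 2)^-1 * quad S z.
  rewrite /affine_Cg addr0 /quad re_complex_row im_complex_row.
  by rewrite !(bilinZl, bilinZr) !mulrA -invfM -expr2 mulrDr.
apply/seteqP; split => z; rewrite /preimage /mkset /qball /= !qnorm_lt // E;
  by rewrite expr1n ltr_pdivrMl ?exprn_gt0 // mulr1.
Qed.

Lemma Cg_volume_qball r : 0 < r ->
  Cg_volume (qball r) = ((r ^+ (g + g))%:E * Cg_volume (qball 1))%E.
Proof.
move=> r0; rewrite qballE // Cg_volume_affine ?invr_gt0 //; last first.
  exact: Cg_measurable_qball.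
by rewrite -invfM exprVn invrK exprMn -exprD.
Qed.

(** Together with [qball1_sub_cube], this shows that the unit ball has positive and finite volume,
    which is all that is used of that volume besides its scaling. *)
Lemma cube_sub_qball : exists2 c, 0 < c & cube 0 c `<=` qball 1.
Proof.
pose K := 2 * mx_abs S + 1.
have K1 : 1 <= K.
  by rewrite lerDr mulr_ge0 //; apply: sumr_ge0 => i _; exact: sumr_ge0.
have K0 : 0 < K by exact: lt_le_trans K1.
exists K^-1; first by rewrite invr_gt0.
move=> z Hz; rewrite /qball /= qnorm_lt // expr1n.
have h1 j : `|re_row z 0 j| <= K^-1.
  by have [/andP[a b] _] := Hz j; rewrite subr0 in a b; rewrite ger0_norm //
    ltW.
have h2 j : `|im_row z 0 j| <= K^-1.
  by have [_ /andP[a b]] := Hz j; rewrite subr0 in a b; rewrite ger0_norm //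
    ltW.
have := bilin_le S h1 h1; have := bilin_le S h2 h2.
rewrite !ger0_norm ?bilin_ge0 // => b2 b1.
apply: le_lt_trans (lerD b1 b2) _.
rewrite -mulrDr -invfM mulrC ltr_pdivrMr ?mulr_gt0 // mul1r.
apply: lt_le_trans (_ : K <= _); first by rewrite /K; lra.
by rewrite ler_peMr // ltW.
Qed.

Lemma bounded_sub_cube (A : set 'rV[R[i]]_g) (M : R) : 0 < M ->
  (forall z j, A z -> `|re_row z 0 j| < M /\ `|im_row z 0 j| < M) ->
  exists v, A `<=` cube v (2 * M).
Proof.
move=> M0 AM; exists (complex_row (const_mx (- M)) (const_mx (- M))).
move=> z Az j; rewrite re_rowD im_rowD re_rowN im_rowN.
rewrite re_complex_row im_complex_row !mxE.
have [] := AM z j Az; rewrite !mxE !ltr_norml => /andP[a b] /andP[c d].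
by split; apply/andP; split; lra.
Qed.

Lemma qball1_sub_cube : exists2 c, 0 < c & exists v, qball 1 `<=` cube v c.
Proof.
pose M := e^-1 + 1.
have M0 : 0 < M by rewrite addr_gt0 ?invr_gt0.
have M1 : 1 <= M by rewrite lerDr invr_ge0 ltW.
exists (2 * M); first by rewrite mulr_gt0.
apply: bounded_sub_cube => // z j; rewrite /qball /= qnorm_lt // expr1n /quad.
have h p : bilin S p p < 1 -> `|p 0 j| < M.
  move=> p1; rewrite -(@ltr_pXn2r _ 2) ?nnegrE ?(ltW M0) //.
  rewrite real_normK ?num_real //.
  apply: lt_le_trans (_ : e^-1 <= _).
    by rewrite -[X in _ < X]mulr1 ltr_pdivlMl //; apply: le_lt_trans p1; exact:
      entry_sqr_le.
  apply: le_trans (_ : M <= _); first by rewrite lerDl.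
  by rewrite expr2 ler_peMr // ltW.
have := bilin_ge0 (re_row z); have := bilin_ge0 (im_row z).
by move=> i0 r0 ri; split; apply: h; lra.
Qed.

Lemma Cg_volume_qball1_gt0 : (0 < Cg_volume (qball 1))%E.
Proof.
have [c c0 cb] := cube_sub_qball.
apply: lt_le_trans (le_Cg_volume (Cg_measurable_cube _ c0) (Cg_measurable_qball
  1) cb).
by rewrite Cg_volume_cube // lte_fin exprn_gt0.
Qed.

Lemma Cg_volume_qball1_fin : Cg_volume (qball 1) \is a fin_num.
Proof.
have [c c0 [v cb]] := qball1_sub_cube.
rewrite ge0_fin_numE ?Cg_volume_ge0 //.
apply: le_lt_trans (le_Cg_volume (Cg_measurable_qball 1) (Cg_measurable_cube v
  c0) cb) _.
by rewrite Cg_volume_cube // ltry.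
Qed.

End Coercive.
End BilinearForm.

(** * The Hermitian form of a real symmetric matrix *)

Section HermitianForm.
Variables (R : realType) (g : nat) (S : 'M[R]_g) (e : R).
Hypothesis S_sym : S^T = S.
Hypothesis e_gt0 : 0 < e.
Hypothesis S_coercive : forall p : 'rV[R]_g,
  e * \sum_j p 0 j ^+ 2 <= bilin S p p.
Implicit Types (z u : 'rV[R[i]]_g).

(** The form $z S \bar u^T$, expanded for a real matrix S. *)
Definition herm z u : R[i] :=
  ((bilin S (re_row z) (re_row u) + bilin S (im_row z) (im_row u)) +i*
   (bilin S (im_row z) (re_row u) - bilin S (re_row z) (im_row u)))%C.

Lemma re_rowZ (a : R[i]) z :
  re_row (a *: z) = complex.Re a *: re_row z - complex.Im a *: im_row z.
Proof.
by apply/rowP => j; rewrite !mxE; case: a => a b; case: (z 0 j) => c d.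
Qed.

Lemma im_rowZ (a : R[i]) z :
  im_row (a *: z) = complex.Re a *: im_row z + complex.Im a *: re_row z.
Proof.
by apply/rowP => j; rewrite !mxE; case: a => a b; case: (z 0 j) => c d.
Qed.

Lemma herm_bilinear :
  bilinear_for *%R (Num.conj \; *%R) (herm : _ -> _ -> R[i]).
Proof.
split=> u; [move=> a x y | move=> a x y]; apply/eqP; rewrite eq_complex /herm;
  rewrite !re_rowD !im_rowD !re_rowZ !im_rowZ; case: a => a b /=;
  rewrite !(bilinDl, bilinDr, bilinZl, bilinZr, bilinNl, bilinNr);
  by apply/andP; split; apply/eqP; ring.
Qed.

HB.instance Definition _ := bilinear_isBilinear.Build R[i] 'rV[R[i]]_g
  'rV[R[i]]_g R[i] _ _ herm herm_bilinear.

Lemma herm_hermitian z u : herm z u = (-1) ^+ false * Num.conj (herm u z).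
Proof.
rewrite expr0 mul1r; apply/eqP; rewrite eq_complex /herm /=.
rewrite (bilinC (re_row z) (re_row u)) // (bilinC (im_row z) (im_row u)) //.
rewrite (bilinC (re_row z) (im_row u)) // (bilinC (im_row z) (re_row u)) //.
by rewrite opprB !eqxx.
Qed.

HB.instance Definition _ := isHermitianSesquilinear.Build R[i] 'rV[R[i]]_g
  false Num.conj herm herm_hermitian.

Lemma herm_gt0 z : z != 0 -> 0 < herm z z.
Proof.
move=> z0; rewrite ltcE /=.
rewrite (bilinC (im_row z) (re_row z)) // subrr eqxx /=.
exact: (@quad_gt0 R g S e e_gt0 S_coercive z z0).
Qed.

HB.instance Definition _ := isDotProduct.Build R[i] 'rV[R[i]]_g herm herm_gt0.

Definition herm_dot : {dot 'rV[R[i]]_g for Num.conj} := herm.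

End HermitianForm.

(** * Counting points in balls by tilings *)

Section Tiling.
Variables (R : realType) (g : nat) (S : 'M[R]_g) (e : R).
Hypothesis S_sym : S^T = S.
Hypothesis e_gt0 : 0 < e.
Hypothesis S_coercive : forall p : 'rV[R]_g,
  e * \sum_j p 0 j ^+ 2 <= bilin S p p.
Implicit Types (z v : 'rV[R[i]]_g) (L F : set 'rV[R[i]]_g).

Lemma coercive_unitmx : S \in unitmx.
Proof.
rewrite unitmxE unitfE; apply/negP => /det0P[p p0 pS].
by move/eqP: p0; apply; apply: (bilin_eq0 e_gt0 S_coercive); rewrite /bilin pS
  mul0mx mxE.
Qed.

Definition is_tile L F : Prop :=
  [/\ Cg_measurable F, forall z, exists2 v, L v & F (z - v) &
      forall v v' z, L v -> L v' -> F (z - v) -> F (z - v') -> v = v'].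

Lemma sume_const_seq (I : Type) (s : seq I) (c : \bar R) :
  (\sum_(i <- s) c = (size s)%:R%:E * c)%E.
Proof.
elim: s => [|i s IH]; first by rewrite big_nil mul0e.
rewrite big_cons IH !mule_natl /=; case: (size s) => [|n]; last by [].
by rewrite mule0n adde0.
Qed.

Definition tiles (s : seq 'rV[R[i]]_g) F : set 'rV[R[i]]_g :=
  [set z | exists2 v, v \in s & F (z - v)].

(** The tiles at the points of s are disjoint and lie in the ball enlarged by d. *)
Lemma count_le L F (d r : R) (s : seq 'rV[R[i]]_g) : is_tile L F ->
  (forall z, F z -> qnorm S z <= d) ->
  uniq s -> (forall v, v \in s -> L v /\ qnorm S v < r) ->
  ((size s)%:R%:E * Cg_volume F <= Cg_volume (qball S (r + d)))%E.
Proof.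
move=> [mF _ uF] Fd us sL.
have -> : ((size s)%:R%:E * Cg_volume F =
    Cg_volume (tiles s F))%E.
  rewrite Cg_volume_bigU //.
  - under eq_bigr do rewrite Cg_volume_translate //.
    by rewrite sume_const_seq.
  - by move=> v _; exact: Cg_measurable_translate.
  - by move=> v v' z /sL[Lv _] /sL[Lv' _]; exact: uF.
apply: le_Cg_volume.
- by apply: Cg_measurable_bigU => v _; exact: Cg_measurable_translate.
- exact: Cg_measurable_qball e_gt0 S_coercive _.
move=> z /= [v /sL[_ vr] Fz]; rewrite /qball /= -(subrK v z) addrC.
apply: le_lt_trans (qnormD S_sym e_gt0 S_coercive _ _) _.
by apply: ltr_leD => //; exact: Fd.
Qed.

(** The tiles at all points of norm below r cover the ball shrunk by d. *)
Lemma count_ge L F (d r : R) : is_tile L F ->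
  (forall z, F z -> qnorm S z <= d) ->
  (0 < Cg_volume F)%E ->
  exists s : seq 'rV[R[i]]_g,
    [/\ uniq s, forall v, v \in s -> L v /\ qnorm S v < r &
     (Cg_volume (qball S (r - d)) <= (size s)%:R%:E * Cg_volume F)%E].
Proof.
move=> tF Fd F0; have [mF cF uF] := tF.
(* Finiteness of the set of points in the ball is not known beforehand: [count_le] bounds the length
   of any list of them, and a list of maximal length exhausts them. *)
pose P (n : nat) := `[< exists s : seq 'rV[R[i]]_g,
  [/\ uniq s, forall v, v \in s -> L v /\ qnorm S v < r & size s = n] >].
have P0 : exists n, P n by exists 0%N; apply/asboolP; exists [::].
have Pfin : exists N, forall n, P n -> (n <= N)%N.
  have [rd0|rd0] := leP (r + d) 0.
    exists 0%N => n /asboolP[[|v s] [us sL <-]] //.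
    have [_ vr] := sL v (mem_head _ _).
    have [v' _ Fv] := cF 0; have := Fd _ Fv.
    have := qnorm_ge0 S v; have := qnorm_ge0 S (0 - v'); lra.
  have fB : Cg_volume (qball S (r + d)) \is a fin_num.
    rewrite (Cg_volume_qball e_gt0 S_coercive) // fin_numM //.
    exact: (Cg_volume_qball1_fin e_gt0 S_coercive).
  have [M MB] : exists M : nat, (Cg_volume (qball S (r + d)) <= M%:R%:E *
    Cg_volume F)%E.
    have [Ffin|] := boolP (Cg_volume F \is a fin_num).
      exists (Num.truncn (fine (Cg_volume (qball S (r + d))) / fine (Cg_volume
        F))).+1.
      rewrite -[X in (X <= _)%E]fineK // -[X in (_ * X)%E]fineK // -EFinM
        lee_fin.
      rewrite -ler_pdivrMr ?ltW ?truncnS_gt // fine_gt0 // F0 /=.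
      by rewrite ltey_eq Ffin.
    rewrite ge0_fin_numE ?Cg_volume_ge0 // -leNgt leye_eq => /eqP ->.
    by exists 1%N; rewrite mul1e leey.
  exists M => n /asboolP[s [us sL <-]].
  have := le_trans (count_le tF Fd us sL) MB.
  have [Ffin|] := boolP (Cg_volume F \is a fin_num).
    rewrite -[Cg_volume F]fineK // -!EFinM lee_fin ler_pM2r ?ler_nat //.
    by rewrite fine_gt0 // F0 /= ltey_eq Ffin.
  rewrite ge0_fin_numE ?Cg_volume_ge0 // -leNgt leye_eq => /eqP Foo.
  case: s us sL => [|v s] us sL //.
  have := count_le tF Fd us sL; rewrite Foo gt0_muley ?lte_fin ?ltr0n //
    leye_eq.
  by move=> /eqP Boo; move: fB; rewrite Boo.
have [N NP] := Pfin.
case: (ex_maxnP P0 NP) => n /asboolP[s [us sL sn]] n_max.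
exists s; split => //.
have Ls v : L v -> qnorm S v < r -> v \in s.
  move=> Lv vr; apply: contraT => vs.
  have : P n.+1.
    apply/asboolP; exists (v :: s); split => //=; first by rewrite vs.
    - by move=> w; rewrite in_cons => /orP[/eqP -> //|]; exact: sL.
    - by rewrite sn.
  by move/n_max; rewrite ltnn.
apply: le_trans (_ : (Cg_volume (tiles s F) <= _)%E).
  apply: le_Cg_volume.
  - exact: Cg_measurable_qball e_gt0 S_coercive _.
  - by apply: Cg_measurable_bigU => v _; exact: Cg_measurable_translate.
  move=> z; rewrite /qball /= => zr.
  have [v Lv Fz] := cF z; exists v => //; apply: Ls => //.
  have -> : v = z + - (z - v) by rewrite opprB addrC subrK.
  apply: le_lt_trans (qnormD S_sym e_gt0 S_coercive _ _) _.
  by rewrite qnormN; have := Fd _ Fz; lra.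
apply: le_trans (Cg_volume_bigU_le _) _.
  by move=> v _; exact: Cg_measurable_translate.
under eq_bigr do rewrite Cg_volume_translate //.
by rewrite sume_const_seq.
Qed.

End Tiling.

(** * A fundamental domain for sheared lattices *)

Section ParallelepipedTile.
Variables (R : realType) (g : nat).
Implicit Types (T A S : 'M[R]_g) (x y : 'rV[int]_g) (z v : 'rV[R[i]]_g).

Definition intr_row x : 'rV[R]_g := map_mx intr x.

Lemma rowB (p w : 'rV[R]_g) j : (p - w) 0 j = p 0 j - w 0 j.
Proof. by rewrite !mxE. Qed.

Lemma intr_rowE x j : intr_row x 0 j = (x 0 j)%:~R.
Proof. by rewrite mxE. Qed.

(** T is kept apart from the matrix S of the norm: the fine lattice takes T = N S while lengths are
    still measured by S. *)
Definition lat_vec T A x y : 'rV[R[i]]_g :=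
  complex_row (intr_row x) ((intr_row y + intr_row x *m A) *m invmx T).

Definition lat T A : set 'rV[R[i]]_g :=
  [set v | exists x y, v = lat_vec T A x y].

(** The slope A is absent: a shear slides the tiles over each x along the imaginary directions, so
    that one tile serves all slopes. It is half-open so as to tile without overlap. *)
Definition par_tile T : set 'rV[R[i]]_g :=
  [set z | forall j, 0 <= re_row z 0 j < 1 /\ 0 <= (im_row z *m T) 0 j < 1].

Lemma Cg_measurable_par_tile T : Cg_measurable (par_tile T).
Proof.
rewrite /Cg_measurable (_ : _ @^-1` _ = \bigcap_(j in [set: 'I_g])
  ((fun t : (g + g).-tuple R => tnth t (lshift g j)) @^-1` `[0, 1[%classic `&`
   (fun t : (g + g).-tuple R => \sum_k tnth t (rshift g k) * T k j) @^-1`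
     `[0, 1[%classic)).
  apply: fin_bigcap_measurable => // j _; apply: measurableI.
    rewrite -[X in measurable X]setTI; exact: measurable_tnth.
  rewrite -[X in measurable X]setTI.
  have mf : measurable_fun setT
      (fun t : (g + g).-tuple R => \sum_k tnth t (rshift g k) * T k j).
    apply: measurable_sum => k; apply: measurable_funM => //.
    exact: measurable_tnth.
  by apply: mf => //; exact: measurable_itv.
have E (t : (g + g).-tuple R) j :
    (im_row (tuple_to_Cg t) *m T) 0 j = \sum_k tnth t (rshift g k) * T k j.
  by rewrite mxE; apply: eq_bigr => k _; rewrite !mxE.
apply/seteqP; split => t.
  move=> H j _; have [] := H j; rewrite E !mxE /= => h1 h2.
  by split; rewrite /= in_itv /= ?h1 ?h2.
move=> H j; have [] := H j Logic.I; rewrite /= !in_itv /= => h1 h2.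
by rewrite E !mxE /= h1 h2.
Qed.

Lemma lat_is_tile T A : T \in unitmx -> is_tile (lat T A) (par_tile T).
Proof.
move=> uT; have E z x y : re_row (z - lat_vec T A x y) = re_row z - intr_row x
  /\
    im_row (z - lat_vec T A x y) *m T =
      im_row z *m T - intr_row y - intr_row x *m A.
  rewrite re_rowD im_rowD re_rowN im_rowN re_complex_row im_complex_row.
  by rewrite mulmxDl mulNmx mulmxKV // opprD addrA.
split; first exact: Cg_measurable_par_tile.
- move=> z; pose x : 'rV[int]_g := \row_j Num.floor (re_row z 0 j).
  pose y : 'rV[int]_g :=
    \row_j Num.floor ((im_row z *m T - intr_row x *m A) 0 j).
  exists (lat_vec T A x y); first by exists x, y.
  have [e1 e2] := E z x y; rewrite /par_tile /= e1 e2 => j.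
  have h (a : R) : 0 <= a - (Num.floor a)%:~R < 1.
    by rewrite subr_ge0 floor_le ltrBlDl -intrD1 floorD1_gt.
  split; first by rewrite rowB intr_rowE [x 0 j]mxE; exact: h.
  by rewrite addrAC rowB intr_rowE [y 0 j]mxE; exact: h.
move=> v v' z [x [y ->]] [x' [y' ->]]; rewrite /par_tile /=.
have [-> ->] := E z x y; have [-> ->] := E z x' y' => H H'.
have eq_int (a : R) (m n : int) : 0 <= a - m%:~R < 1 -> 0 <= a - n%:~R < 1 -> m
  = n.
  move=> h1 h2; have e1 : Num.floor a = m by apply: floor_def; lra.
  have e2 : Num.floor a = n by apply: floor_def; lra.
  by rewrite -e1 e2.
have xx : x = x'.
  apply/rowP => j; have [+ _] := H j; have [+ _] := H' j.
  by rewrite !rowB !intr_rowE => h h'; exact: eq_int h' h.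
have -> : y = y'; last by rewrite xx.
apply/rowP => j; have [_ +] := H j; have [_ +] := H' j.
have AC (a b c : 'rV[R]_g) : (a - b - c) 0 j = (a - c) 0 j - b 0 j.
  by rewrite !rowB addrAC.
by rewrite xx !AC !intr_rowE => h h'; exact: eq_int h' h.
Qed.

Lemma Cg_volume_par_tile_scale T (b : R) : 0 < b ->
  Cg_volume (par_tile (b *: T)) = ((b ^+ g)^-1%:E * Cg_volume (par_tile T))%E.
Proof.
move=> b0; rewrite (_ : par_tile (b *: T) = affine_Cg 1 b 0 @^-1` par_tile T).
  by rewrite Cg_volume_affine // ?mul1r //; exact: Cg_measurable_par_tile.
apply/seteqP; split => z H j; have := H j;
  by rewrite /affine_Cg addr0 re_complex_row im_complex_row scale1r
    -scalemxAr -scalemxAl.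
Qed.

Lemma mulmx_entry_le (w : 'rV[R]_g) T (c : R) j : 0 <= c ->
  (forall k, `|w 0 k| <= c) -> `|(w *m T) 0 j| <= c * mx_abs T.
Proof.
move=> c0 wc; rewrite mxE /mx_abs mulr_sumr.
apply: le_trans (ler_norm_sum _ _ _) _; apply: ler_sum => k _.
rewrite normrM; apply: ler_pM => //.
by rewrite (bigD1 j) //= lerDl; apply: sumr_ge0.
Qed.

Lemma mx_abs_ge0 T : 0 <= mx_abs T.
Proof. by apply: sumr_ge0 => i _; exact: sumr_ge0. Qed.

Lemma Cg_volume_par_tile_gt0 T : T \in unitmx -> (0 < Cg_volume (par_tile T))%E.
Proof.
move=> uT; pose c := (2 * (mx_abs T + 1))^-1.
have K0 := mx_abs_ge0 T.
have c0 : 0 < c by rewrite invr_gt0 mulr_gt0 // ltr_wpDl.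
have c1 : c <= 1 by rewrite invf_le1; lra.
have cT : c * mx_abs T < 2^-1.
  rewrite mulrC ltr_pdivrMr; last by lra.
  by lra.
(* The cube starts at a corner, which suits the real part; the imaginary part starts at the centre
   of the tile, since T may have entries of either sign. *)
pose v := complex_row 0 (const_mx 2^-1 *m invmx T).
suff vF : cube v c `<=` par_tile T.
  apply: lt_le_trans (le_Cg_volume (Cg_measurable_cube v c0)
    (Cg_measurable_par_tile T) vF).
  by rewrite Cg_volume_cube // lte_fin exprn_gt0.
move=> z Hz j; split.
  have [/andP[h1 h2] _] := Hz j.
  move: h1 h2; rewrite re_rowD re_rowN re_complex_row oppr0 addr0 => h1 h2.
  by rewrite h1 (lt_le_trans h2).
pose w := im_row (z - v).
have wc k : `|w 0 k| <= c.
  by have [_ /andP[h1 h2]] := Hz k; rewrite ger0_norm // ltW.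
have -> : im_row z *m T = w *m T + const_mx 2^-1.
  rewrite /w im_rowD im_rowN im_complex_row mulmxDl mulNmx mulmxKV //.
  by rewrite subrK.
rewrite mxE [const_mx _ 0 j]mxE.
have := le_lt_trans (mulmx_entry_le T j (ltW c0) wc) cT.
rewrite ltr_norml => /andP[h1 h2].
by apply/andP; split; lra.
Qed.

Lemma Cg_volume_par_tile_fin T :
  T \in unitmx -> Cg_volume (par_tile T) \is a fin_num.
Proof.
move=> uT; have K0 := mx_abs_ge0 (invmx T).
pose M := 2 + mx_abs (invmx T).
have M0 : 0 < M by rewrite /M; lra.
have [v vF] : exists v, par_tile T `<=` cube v (2 * M).
  apply: bounded_sub_cube => // z j Hz; split.
    have [/andP[h1 h2] _] := Hz j; rewrite ger0_norm // /M; lra.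
  have -> : im_row z = (im_row z *m T) *m invmx T by rewrite mulmxK.
  have h k : `|(im_row z *m T) 0 k| <= 1.
    by have [_ /andP[h1 h2]] := Hz k; rewrite ger0_norm // ltW.
  have := mulmx_entry_le (invmx T) j ler01 h; rewrite /M; lra.
have M2 : 0 < 2 * M by rewrite mulr_gt0.
rewrite ge0_fin_numE ?Cg_volume_ge0 //.
apply: le_lt_trans (le_Cg_volume (Cg_measurable_par_tile T)
  (Cg_measurable_cube v M2) vF) _.
by rewrite Cg_volume_cube // ltry.
Qed.

(** The imaginary part is w S^-1 / b with the entries of w in [0, 1[, so its squared norm is w S^-1
    w^T / b^2. Used with b = 1 for the packing density and with b = N for the fine lattice. *)
Lemma qnorm_par_tile_le S (b : R) z : S^T = S -> S \in unitmx -> 0 < b ->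
  par_tile (b *: S) z ->
  qnorm S z <= Num.sqrt (mx_abs S + (b ^+ 2)^-1 * mx_abs (invmx S)).
Proof.
move=> SS uS b0 Hz; rewrite /qnorm ler_wsqrtr //; apply: lerD.
  apply: le_trans (ler_norm _) _; rewrite -[X in _ <= X]mul1r -[X in _ <= X *
    _]mul1r.
  by apply: bilin_le => j; have [/andP[h1 h2] _] := Hz j; rewrite ger0_norm //
    ltW.
pose w := im_row z *m (b *: S).
have uinv : (invmx S)^T = invmx S by rewrite trmx_inv SS.
have -> : bilin S (im_row z) (im_row z) = (b ^+ 2)^-1 * bilin (invmx S) w w.
  have -> : im_row z = b^-1 *: (w *m invmx S).
    rewrite /w -scalemxAr -scalemxAl scalerA mulVf ?gt_eqF // scale1r.
    by rewrite mulmxK.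
  rewrite bilinZl bilinZr mulrA -invfM -expr2; congr (_ * _).
  by rewrite /bilin trmx_mul uinv mulmxKV // mulmxA.
rewrite ler_wpM2l ?invr_ge0 ?exprn_ge0 ?(ltW b0) //.
apply: le_trans (ler_norm _) _; rewrite -[X in _ <= X]mul1r -[X in _ <= X *
  _]mul1r.
by apply: bilin_le => j; have [_ /andP[h1 h2]] := Hz j; rewrite ger0_norm //
  ltW.
Qed.

End ParallelepipedTile.

(** * The abelian varieties and their packing densities *)

Section LatticeVariety.
Variables (R : realType) (g : nat) (S : 'M[R]_g) (e : R) (A : 'M[R]_g).
Hypothesis S_sym : S^T = S.
Hypothesis e_gt0 : 0 < e.
Hypothesis S_coercive : forall p : 'rV[R]_g,
  e * \sum_j p 0 j ^+ 2 <= bilin S p p.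
Hypothesis A_sym : A^T = A.
Implicit Types (p q : 'rV[R]_g).

Let S_unit : S \in unitmx := coercive_unitmx e_gt0 S_coercive.

(** Real coordinates in which the lattice is Z^g x Z^g and the imaginary part of the form is the
    standard symplectic form. *)
Definition real_vec p q : 'rV[R[i]]_g :=
  complex_row p ((q + p *m A) *m invmx S).

Lemma lat_vecE x y : lat_vec S A x y = real_vec (intr_row R x) (intr_row R y).
Proof. by []. Qed.

Lemma real_vecD p q p' q' :
  real_vec (p + p') (q + q') = real_vec p q + real_vec p' q'.
Proof.
rewrite /real_vec (mulmxDl p) addrACA mulmxDl.
by apply/rowP => j; rewrite !mxE.
Qed.

Lemma real_vecZ (a : R) p q :
  real_vec (a *: p) (a *: q) = (a%:C)%C *: real_vec p q.
Proof.
rewrite /real_vec -scalemxAl -scalerDr -scalemxAl.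
apply/rowP => j; rewrite !mxE; apply/eqP.
by rewrite eq_complex /= !mul0r subr0 addr0 !eqxx.
Qed.

Lemma real_vec0 : real_vec 0 0 = 0.
Proof.
rewrite -[X in real_vec X 0](scale0r 0) -[X in real_vec _ X](scale0r 0).
by rewrite real_vecZ scale0r.
Qed.

Lemma real_vec_sum (I : finType) (p q : I -> 'rV[R]_g) :
  real_vec (\sum_i p i) (\sum_i q i) = \sum_i real_vec (p i) (q i).
Proof.
elim/big_rec3: _ => [|i u v w _ <-]; first exact: real_vec0.
by rewrite real_vecD.
Qed.

Definition real_coord (z : 'rV[R[i]]_g) : 'rV[R]_g :=
  im_row z *m S - re_row z *m A.

Lemma real_vecK z : real_vec (re_row z) (real_coord z) = z.
Proof. by rewrite /real_vec subrK mulmxK // complex_row_eta. Qed.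

Lemma re_real_vec p q : re_row (real_vec p q) = p.
Proof. exact: re_complex_row. Qed.

Lemma real_coordK p q : real_coord (real_vec p q) = q.
Proof.
by rewrite /real_coord re_real_vec im_complex_row mulmxKV // addrK.
Qed.

(** Symmetry of A makes the two terms p A p'^T cancel, so every slope gives the same symplectic
    form. *)
Lemma Im_herm_real_vec p q p' q' :
  complex.Im (herm S (real_vec p q) (real_vec p' q'))
    = (q *m p'^T) 0 0 - (p *m q'^T) 0 0.
Proof.
rewrite /herm /= !re_complex_row !im_complex_row /bilin mulmxKV //.
rewrite trmx_mul trmx_inv S_sym mulmxA mulmxK //.
have -> : (q' + p' *m A)^T = q'^T + A *m p'^T.
  by rewrite linearD /= trmx_mul A_sym.
have mxD (M N : 'M[R]_1) : (M + N) 0 0 = M 0 0 + N 0 0 by rewrite mxE.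
by rewrite mulmxDl mulmxDr mulmxA !mxD; ring.
Qed.

Lemma two_mul_add : (2 * g = g + g)%N.
Proof. by rewrite mul2n addnn. Qed.

Definition lat_basis (i : 'I_(2 * g)) : 'rV[R[i]]_g :=
  match fintype.split (cast_ord two_mul_add i) with
  | inl j => real_vec (delta_mx 0 j) 0
  | inr j => real_vec 0 (delta_mx 0 j)
  end.

Definition left_index (j : 'I_g) : 'I_(2 * g) :=
  cast_ord (esym two_mul_add) (lshift g j).
Definition right_index (j : 'I_g) : 'I_(2 * g) :=
  cast_ord (esym two_mul_add) (rshift g j).

Lemma lat_basis_left j : lat_basis (left_index j) = real_vec (delta_mx 0 j) 0.
Proof.
by rewrite /lat_basis /left_index cast_ordKV (@unsplitK g g (inl j)).
Qed.

Lemma lat_basis_right j : lat_basis (right_index j) = real_vec 0 (delta_mx 0 j).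
Proof.
by rewrite /lat_basis /right_index cast_ordKV (@unsplitK g g (inr j)).
Qed.

Lemma sum_2g (V : zmodType) (F : 'I_(2 * g) -> V) :
  \sum_i F i = \sum_j F (left_index j) + \sum_j F (right_index j).
Proof.
rewrite (reindex (cast_ord (esym two_mul_add))) /=; last first.
  by exists (cast_ord two_mul_add) => i _; rewrite ?cast_ordK ?cast_ordKV.
by rewrite big_split_ord.
Qed.

Lemma index_2gP (i : 'I_(2 * g)) :
  (exists j, i = left_index j) \/ (exists j, i = right_index j).
Proof.
rewrite -(cast_ordK two_mul_add i) -(splitK (cast_ord two_mul_add i)).
by case: fintype.split => j; [left|right]; exists j.
Qed.

Lemma sum_lat_basis (a : 'I_(2 * g) -> R) :
  \sum_i (a i)%:C%C *: lat_basis i =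
    real_vec (\row_j a (left_index j)) (\row_j a (right_index j)).
Proof.
rewrite sum_2g.
under eq_bigr do rewrite lat_basis_left -real_vecZ scaler0.
under [X in _ + X]eq_bigr do rewrite lat_basis_right -real_vecZ scaler0.
rewrite -!real_vec_sum -real_vecD !big1_eq addr0 add0r.
rewrite [X in real_vec X _](_ : _ = \row_j a (left_index j)); last first.
  rewrite [RHS]row_sum_delta; apply: eq_bigr => j _; by rewrite mxE.
congr real_vec; rewrite [RHS]row_sum_delta; apply: eq_bigr => j _; by rewrite
  mxE.
Qed.

Lemma lat_is_lattice : is_lattice (lat S A).
Proof.
exists lat_basis; split.
  move=> z.
  exists [ffun i => match fintype.split (cast_ord two_mul_add i) with
    | inl j => re_row z 0 j | inr j => real_coord z 0 j end].
  have El j : fintype.split (cast_ord two_mul_add (left_index j)) = inl j.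
    by rewrite cast_ordKV (@unsplitK g g (inl j)).
  have Er j : fintype.split (cast_ord two_mul_add (right_index j)) = inr j.
    by rewrite cast_ordKV (@unsplitK g g (inr j)).
  split.
    rewrite sum_lat_basis -[LHS]real_vecK; congr real_vec; apply/rowP => j.
      by rewrite [RHS]mxE ffunE El.
    by rewrite [RHS]mxE ffunE Er.
  move=> a; rewrite sum_lat_basis => zE; apply/ffunP => i; rewrite ffunE.
  have [[j ->]|[j ->]] := index_2gP i; rewrite ?El ?Er zE.
    by rewrite re_real_vec mxE.
  by rewrite real_coordK mxE.
have E (k : 'I_(2 * g) -> int) : \sum_i lat_basis i *~ k i =
    lat_vec S A (\row_j k (left_index j)) (\row_j k (right_index j)).
  rewrite lat_vecE.
  have -> : \sum_i lat_basis i *~ k i =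
      \sum_i ((k i)%:~R : R)%:C%C *: lat_basis i.
    by apply: eq_bigr => i _; rewrite rmorph_int scaler_int.
  by rewrite sum_lat_basis; congr real_vec; apply/rowP => j; rewrite !mxE.
apply/seteqP; split => z.
  move=> [x [y ->]]; exists (fun i =>
    match fintype.split (cast_ord two_mul_add i) with
    | inl j => x 0 j | inr j => y 0 j end).
  rewrite E; congr lat_vec; apply/rowP => j; rewrite mxE cast_ordKV.
    by rewrite (@unsplitK g g (inl j)).
  by rewrite (@unsplitK g g (inr j)).
by move=> [k ->]; rewrite E; exists (\row_j k (left_index j)), (\row_j k
  (right_index j)).
Qed.

Lemma lat_integral z u : lat S A z -> lat S A u ->
  complex.Im (herm S z u) \is a Num.int.
Proof.
move=> [x [y ->]] [x' [y' ->]]; rewrite !lat_vecE Im_herm_real_vec.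
have h (a b : 'rV[int]_g) : (intr_row R a *m (intr_row R b)^T) 0 0 \is a
  Num.int.
  rewrite mxE; apply: rpred_sum => j _; rewrite !mxE; apply: rpredM; exact:
    intr_int.
by rewrite rpredB.
Qed.

(** The standard symplectic form is unimodular: pairing z with the basis vectors reads off its
    coordinates up to sign. *)
Lemma lat_principal z :
  (forall u, lat S A u -> complex.Im (herm S z u) \is a Num.int) -> lat S A z.
Proof.
move=> H; pose q := real_coord z; pose p := re_row z.
have pairE (a b : 'rV[R]_g) : (a *m b^T) 0 0 = \sum_j a 0 j * b 0 j.
  by rewrite mxE; apply: eq_bigr => j _; rewrite mxE.
have pairD (a : 'rV[R]_g) j : (a *m (intr_row R (delta_mx 0 j))^T) 0 0 = a 0 j.
  rewrite pairE (bigD1 j) //= !mxE !eqxx mulr1 big1 ?addr0 // => k kj.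
  by rewrite !mxE (negbTE kj) andbF mulr0.
have pair0 (a : 'rV[R]_g) : (a *m (intr_row R 0)^T) 0 0 = 0.
  by rewrite pairE big1 // => j _; rewrite !mxE mulr0.
have q_int j : q 0 j \is a Num.int.
  have := H (lat_vec S A (delta_mx 0 j) 0).
  rewrite -{1}(real_vecK z) lat_vecE Im_herm_real_vec pairD pair0 subr0.
  by apply; exists (delta_mx 0 j), 0.
have p_int j : p 0 j \is a Num.int.
  have := H (lat_vec S A 0 (delta_mx 0 j)).
  rewrite -{1}(real_vecK z) lat_vecE Im_herm_real_vec pairD pair0 sub0r rpredN.
  by apply; exists 0, (delta_mx 0 j).
exists (\row_j Num.floor (p 0 j)), (\row_j Num.floor (q 0 j)).
rewrite lat_vecE -[LHS]real_vecK; congr real_vec; apply/rowP => j;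
  by rewrite [RHS]mxE [X in _ = X%:~R]mxE floorK ?p_int ?q_int.
Qed.

Definition lat_ppav : ppav R g :=
  @Ppav R g (lat S A) (herm_dot S_sym e_gt0 S_coercive) lat_is_lattice
    lat_integral lat_principal.

End LatticeVariety.

(** * Packing density from a lower bound on the first minimum *)

Section PackingDensity.
Variables (R : realType) (g : nat) (S : 'M[R]_g) (e : R) (A : 'M[R]_g).
Hypothesis S_sym : S^T = S.
Hypothesis e_gt0 : 0 < e.
Hypothesis S_coercive : forall p : 'rV[R]_g,
  e * \sum_j p 0 j ^+ 2 <= bilin S p p.
Hypothesis A_sym : A^T = A.

Let S_unit : S \in unitmx := coercive_unitmx e_gt0 S_coercive.

Lemma Bernoulli_le (t : R) (n : nat) :
  0 <= t <= 1 -> 1 - n%:R * t <= (1 - t) ^+ n.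
Proof.
case/andP => t0 t1; elim: n => [|n IH]; first by rewrite mul0r subr0 expr0.
rewrite exprS; have := ler_wpM2l (_ : 0 <= 1 - t) IH; rewrite subr_ge0 => /(_
  t1).
apply: le_trans; rewrite -natr1; have : 0 <= n%:R * t ^+ 2 by rewrite mulr_ge0
  ?sqr_ge0.
lra.
Qed.

Definition ball_volume (T : 'M[R]_g) : R := fine (Cg_volume (qball T 1)).
Definition covolume (T : 'M[R]_g) : R := fine (Cg_volume (par_tile T)).

Lemma ball_volumeE : Cg_volume (qball S 1) = (ball_volume S)%:E.
Proof.
by rewrite /ball_volume fineK // (Cg_volume_qball1_fin e_gt0 S_coercive).
Qed.

Lemma ball_volume_gt0 : 0 < ball_volume S.
Proof.
by rewrite -lte_fin -ball_volumeE (Cg_volume_qball1_gt0 e_gt0 S_coercive).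
Qed.

Lemma covolumeE (T : 'M[R]_g) :
  T \in unitmx -> Cg_volume (par_tile T) = (covolume T)%:E.
Proof. by move=> uT; rewrite /covolume fineK // Cg_volume_par_tile_fin. Qed.

Lemma covolume_gt0 (T : 'M[R]_g) : T \in unitmx -> 0 < covolume T.
Proof. by move=> uT; rewrite -lte_fin -covolumeE // Cg_volume_par_tile_gt0. Qed.

Lemma real_vecN p q : real_vec S A (- p) (- q) = - real_vec S A p q.
Proof. by apply/eqP; rewrite -subr_eq0 opprK -real_vecD !addNr real_vec0. Qed.

Lemma lat_sub v v' : lat S A v -> lat S A v' -> lat S A (v - v').
Proof.
move=> [x [y ->]] [x' [y' ->]]; exists (x - x'), (y - y').
rewrite !lat_vecE; have -> : intr_row R (x - x') = intr_row R x - intr_row R x'.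
  by apply/rowP => j; rewrite !mxE rmorphB.
have -> : intr_row R (y - y') = intr_row R y - intr_row R y'.
  by apply/rowP => j; rewrite !mxE rmorphB.
by rewrite real_vecD real_vecN.
Qed.

Lemma Cg_measurable_bigcup_lat (r : R) :
  Cg_measurable (\bigcup_(v in lat S A) [set z | qnorm S (z - v) < r]).
Proof.
rewrite (_ : \bigcup_(v in _) _ = \bigcup_(u : 'rV[int]_g * 'rV[int]_g)
   [set z | qnorm S (z - lat_vec S A u.1 u.2) < r]).
  rewrite /Cg_measurable preimage_bigcup; apply: countable_bigcupT_measurable.
    exact: countableP.
  move=> u; apply: (@Cg_measurable_translate _ _ _ (qball S r)).
  exact: Cg_measurable_qball e_gt0 S_coercive _.
apply/seteqP; split => z.
  by move=> [v [x [y ->]] zv]; exists (x, y).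
by move=> [[x y] _ zv]; exists (lat_vec S A x y) => //; exists x, y.
Qed.

(** Inside the ball of radius r, keep only the disjoint balls of radius [lam / 2] around the lattice
    points of norm below [r - lam / 2], finitely many and counted by [count_ge]. Bernoulli's
    inequality makes the boundary loss linear in 1/r. *)
Lemma packing_ratio_ge (lam l r : R) : 0 < lam -> lam <= l ->
  (forall v, lat S A v -> v != 0 -> lam <= qnorm S v) ->
  lam / 2 + Num.sqrt (mx_abs S + mx_abs (invmx S)) < r ->
  (((lam / 2) ^+ (g + g) * ball_volume S / covolume S
     * (1 - (g + g)%:R
          * ((lam / 2 + Num.sqrt (mx_abs S + mx_abs (invmx S))) / r)))%:E
   <= Cg_volume (qball S r `&`
        \bigcup_(v in lat S A) [set z | qnorm S (z - v) < l / 2]%R)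
      / Cg_volume (qball S r))%E.
Proof.
move=> lam0 laml latlam; set d := Num.sqrt _; set c := _ + d => cr.
have d0 : 0 <= d by exact: sqrtr_ge0.
have c0 : 0 < c by rewrite /c; lra.
have r0 : 0 < r by lra.
have lam2 : 0 < lam / 2 by lra.
have Fd z : par_tile S z -> qnorm S z <= d.
  rewrite -{1}(scale1r S) => /(qnorm_par_tile_le S_sym S_unit ltr01).
  by rewrite expr1n invr1 mul1r.
have [s [us sL sB]] := count_ge S_sym e_gt0 S_coercive (r - lam / 2)
  (lat_is_tile A S_unit) Fd (Cg_volume_par_tile_gt0 S_unit).
pose U := [set z | exists2 v, v \in s & qball S (lam / 2) (z - v)].
have mU : Cg_measurable U.
  apply: Cg_measurable_bigU => v _; apply: Cg_measurable_translate.
  exact: Cg_measurable_qball e_gt0 S_coercive _.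
have volq : Cg_volume (qball S (lam / 2)) =
    ((lam / 2) ^+ (g + g) * ball_volume S)%:E.
  by rewrite (Cg_volume_qball e_gt0 S_coercive lam2) ball_volumeE EFinM.
have volU : Cg_volume U = ((size s)%:R * ((lam / 2) ^+ (g + g) * ball_volume
  S))%:E.
  rewrite /U Cg_volume_bigU //.
  - rewrite [RHS]EFinM -sume_const_seq; apply: eq_bigr => v _.
    rewrite Cg_volume_translate; first exact: volq.
    exact: Cg_measurable_qball e_gt0 S_coercive _.
  - move=> v _; apply: Cg_measurable_translate.
    exact: Cg_measurable_qball e_gt0 S_coercive _.
  move=> v v' z sv sv'; rewrite /qball /= => h1 h2; apply/eqP.
  rewrite -subr_eq0; apply: contraT => vv'.
  have [Lv _] := sL v sv; have [Lv' _] := sL v' sv'.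
  have := latlam _ (lat_sub Lv Lv') vv'.
  have -> : v - v' = (z - v') + - (z - v) by rewrite opprB [RHS]addrC addrA
    subrK.
  have := qnormD S_sym e_gt0 S_coercive (z - v') (- (z - v)).
  rewrite qnormN; lra.
have BP : (Cg_volume U <= Cg_volume (qball S r `&`
    \bigcup_(v in lat S A) [set z | qnorm S (z - v) < l / 2]%R))%E.
  apply: le_Cg_volume => //.
    rewrite /Cg_measurable preimage_setI; apply: measurableI.
      exact: Cg_measurable_qball e_gt0 S_coercive _.
    exact: Cg_measurable_bigcup_lat.
  move=> z [v sv]; rewrite /qball /= => zv; have [Lv vr] := sL v sv; split.
    rewrite -(subrK v z).
    apply: le_lt_trans (qnormD S_sym e_gt0 S_coercive _ _) _; lra.
  by exists v => //=; lra.
have B0 := ball_volume_gt0; have V0 := covolume_gt0 S_unit.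
have volr : Cg_volume (qball S r) = (r ^+ (g + g) * ball_volume S)%:E.
  by rewrite (Cg_volume_qball e_gt0 S_coercive) // ball_volumeE EFinM.
have rg0 : 0 < r ^+ (g + g) by rewrite exprn_gt0.
rewrite volr inver gt_eqF ?mulr_gt0 //.
have lamg0 : 0 < (lam / 2) ^+ (g + g) by rewrite exprn_gt0.
apply: le_trans (lee_wpmul2r _ BP); last by rewrite lee_fin invr_ge0 ltW
  ?mulr_gt0.
rewrite volU -EFinM lee_fin.
have sV : (r - c) ^+ (g + g) * ball_volume S <= (size s)%:R * covolume S.
  move: sB; rewrite covolumeE // (_ : r - lam / 2 - d = r - c); last by rewrite
    /c; lra.
  by rewrite (Cg_volume_qball e_gt0 S_coercive) ?subr_gt0 // ball_volumeE
    -!EFinM lee_fin.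
have Bern : 1 - (g + g)%:R * (c / r) <= ((r - c) / r) ^+ (g + g).
  have -> : (r - c) / r = 1 - c / r by field; rewrite gt_eqF.
  apply: Bernoulli_le; rewrite divr_ge0 ?(ltW c0) ?(ltW r0) //=.
  by rewrite ler_pdivrMr // mul1r ltW.
apply: le_trans (_ : (lam / 2) ^+ (g + g) * ball_volume S / covolume S
    * ((r - c) / r) ^+ (g + g) <= _).
  by rewrite ler_wpM2l // divr_ge0 ?mulr_ge0 ?ltW.
have -> : (size s)%:R * ((lam / 2) ^+ (g + g) * ball_volume S)
    / (r ^+ (g + g) * ball_volume S) = (lam / 2) ^+ (g + g) / covolume S / r ^+
      (g + g)
     * ((size s)%:R * covolume S).
  by field; rewrite !gt_eqF.
rewrite (expr_div_n (r - c)).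
have -> : (lam / 2) ^+ (g + g) * ball_volume S / covolume S
    * ((r - c) ^+ (g + g) / r ^+ (g + g)) =
   (lam / 2) ^+ (g + g) / covolume S / r ^+ (g + g) *
     ((r - c) ^+ (g + g) * ball_volume S).
  by field; rewrite !gt_eqF.
by rewrite ler_wpM2l // !divr_ge0 // ltW.
Qed.

Lemma injectivity_volume_lat_ge (lam : R) : (0 < g)%N -> 0 < lam ->
  (forall v, lat S A v -> v != 0 -> lam <= qnorm S v) ->
  (((lam / 2) ^+ (g + g) * ball_volume S / covolume S)%:E
    <= injectivity_volume (lat_ppav S_sym e_gt0 S_coercive A_sym))%E.
Proof.
move=> g0 lam0 latlam; rewrite /injectivity_volume /packing_density.
set l := lambda1 _ _.
have laml : lam <= l.
  (* The infimum of the empty set is 0 by convention, so a non-zero lattice vector must be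
     exhibited; g > 0 provides one. *)
  apply: lb_le_inf.
    pose v := lat_vec S A (delta_mx 0 (Ordinal g0)) 0.
    exists (qnorm S v); exists v => //; split.
      by exists (delta_mx 0 (Ordinal g0)), 0.
    move=> /= v0; have := congr1 (fun z => re_row z 0 (Ordinal g0)) v0.
    rewrite re_complex_row !mxE !eqxx /= => /eqP; rewrite oner_eq0 //.
  by move=> _ [v [Lv /= v0] <-]; apply: latlam => //; exact/eqP.
set X : R := _ / covolume S.
have X0 : 0 <= X.
  rewrite /X divr_ge0 ?mulr_ge0 ?exprn_ge0 //; try lra.
    exact: ltW ball_volume_gt0.
  exact: ltW (covolume_gt0 S_unit).
(* The upper limit is an infimum of suprema over sets Q containing some ]M, +oo[; one radius r > M
   with a good ratio bounds such a supremum from below. The term K of r makes the boundary loss at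
   most eps. *)
apply: le_ereal_inf_tmp => _ [Q [M [_ MQ]] <-].
apply/lee_addgt0Pr => eps eps0.
pose c := lam / 2 + Num.sqrt (mx_abs S + mx_abs (invmx S)).
have c0 : 0 < c by rewrite /c ltr_pwDl ?sqrtr_ge0 //; lra.
pose n : R := (g + g)%:R.
have n0 : 0 <= n by rewrite ler0n.
pose K := X * n * c / eps.
have K0 : 0 <= K.
  by apply: divr_ge0 (ltW eps0); apply: mulr_ge0 (ltW c0); exact: mulr_ge0.
pose r := `|M| + 1 + c + K.
have rM : M < r by rewrite /r; have := ler_norm M; lra.
have M0 : 0 <= `|M| by [].
have cr : c < r by rewrite /r; lra.
have r0 : 0 < r by lra.
have := packing_ratio_ge lam0 laml latlam cr; rewrite -/X -/c -/n => h.
have Qr := MQ r rM.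
apply: le_trans (_ : ((X * (1 - n * (c / r)))%:E + eps%:E <= _)%E).
  rewrite -EFinD lee_fin.
  have -> : X * (1 - n * (c / r)) + eps = X + (eps - X * n * c / r) by ring.
  rewrite lerDl subr_ge0.
  rewrite ler_pdivrMr //.
  have : K <= r by rewrite /r; lra.
  by rewrite /K ler_pdivrMr // (mulrC r).
apply: leeD2r; apply: le_trans h _; apply: ereal_sup_ubound.
exists r => //.
have -> : riemann_ball (riemann (lat_ppav S_sym e_gt0 S_coercive A_sym)) 0 r =
    qball S r; last by [].
by apply/seteqP; split => z; rewrite /riemann_ball /= subr0.
Qed.

End PackingDensity.

(** * Averaging over Hankel slopes *)

Section HankelFamily.
Variables (n g : nat) (C : 'M[int]_g).
Hypothesis n_gt0 : (0 < n)%N.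
Hypothesis Cn : C ^+ n = 1.
Hypothesis C_free : forall j (x : 'rV_g),
  (0 < j < n)%N -> x *m C ^+ j = x -> x = 0.
Hypothesis C_det : forall x : 'rV_g,
  x != 0 -> \det (\sum_i x 0 i *: C ^+ i) != 0.
Hypothesis C_row : forall i j : 'I_g, row j (C ^+ i) = row i (C ^+ j).
Implicit Types (x y z a : 'rV[int]_g).

(* Identify Z^g with Z[X]/Phi_n and a with a linear functional on it: the (i, j)
   entry is a(X^(i+j)), so that hankel a is the Gram matrix of
   (u, v) |-> a(u v). *)
Definition hankel a : 'M[int]_g := \matrix_(i, j) (row j (C ^+ i) *m a^T) 0 0.

Lemma hankel_sym a : (hankel a)^T = hankel a.
Proof. by apply/matrixP => i j; rewrite !mxE C_row. Qed.

(** The functional v |-> a(x v) is a composed with multiplication by x, whose determinant is the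
    norm of x. *)
Lemma mulmx_hankel x a : x *m hankel a = a *m (\sum_i x 0 i *: C ^+ i)^T.
Proof.
apply/rowP => j; rewrite !mxE.
transitivity (\sum_i \sum_k x 0 i * ((C ^+ i) j k * a 0 k)).
  apply: eq_bigr => i _; rewrite !mxE mulr_sumr.
  by apply: eq_bigr => k _; rewrite !mxE.
rewrite exchange_big; apply: eq_bigr => k _; rewrite !mxE summxE mulr_sumr.
by apply: eq_bigr => i _; rewrite mxE mulrA mulrC.
Qed.

(** This is a((X u) v) = a(u (X v)). *)
Lemma C_hankel a : C *m hankel a = hankel a *m C^T.
Proof.
have E i j : (C *m hankel a) i j = (row i (C ^+ j.+1) *m a^T) 0 0.
  have -> : (C *m hankel a) i j = (row i C *m (C ^+ j *m a^T)) 0 0.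
    rewrite !mxE; apply: eq_bigr => k _; rewrite !mxE; congr (_ * _).
    apply: eq_bigr => l _; have := C_row j k.
    by move/rowP/(_ l); rewrite !mxE => <-.
  rewrite mulmxA exprS; congr ((_ *m _) 0 0).
  by rewrite row_mul.
apply/matrixP => i j; rewrite E.
have -> : (hankel a *m C^T) i j = (C *m hankel a) j i.
  by rewrite -{1}(hankel_sym a) -trmx_mul mxE.
by rewrite E !exprSr !row_mul C_row.
Qed.

Lemma expC_hankel a k : C ^+ k *m hankel a = hankel a *m (C ^+ k)^T.
Proof.
elim: k => [|k IH]; first by rewrite expr0 mul1mx trmx1 mulmx1.
have e : C *m C ^+ k = C ^+ k.+1 by rewrite exprS.
by rewrite {1}exprSr -mulmxA C_hankel mulmxA IH -mulmxA -trmx_mul e.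
Qed.

Lemma mulmx_expC i j : C ^+ i *m C ^+ j = C ^+ (i + j).
Proof. by rewrite exprD. Qed.

Lemma expC_inj x k l : (k < n)%N -> (l < n)%N ->
  x != 0 -> x *m C ^+ k = x *m C ^+ l -> k = l.
Proof.
wlog kl : k l / (k <= l)%N => [H kn ln x0 e|kn ln x0 e].
  by case: (leqP k l) => [kl|/ltnW lk]; [|symmetry]; apply: H => //; rewrite e.
apply/eqP; rewrite eqn_leq kl leqNgt; apply/negP => lt_kl.
case/eqP: x0; apply: (C_free (j := (l - k)%N)).
  by rewrite subn_gt0 lt_kl (leq_ltn_trans (leq_subr _ _)).
have := congr1 (mulmx^~ (C ^+ (n - k))) e; rewrite -!mulmxA !mulmx_expC.
rewrite subnKC ?(ltnW kn) // Cn mulmx1.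
have -> : (l + (n - k) = n + (l - k))%N by clear -kl kn; lia.
by rewrite exprD Cn mul1r => <-.
Qed.

Lemma expC_unit x k : x != 0 -> x *m C ^+ k != 0.
Proof.
apply: contra_neq => e; have := congr1 (mulmx^~ (C ^+ (k * n.-1))) e.
rewrite mul0mx -mulmxA mulmx_expC -mulnS prednK // mulnC exprM Cn expr1n.
by rewrite mulmx1.
Qed.

(** Multiply by the adjugate: N divides det M times each entry, and a prime above |det M| > 0 cannot
    divide det M. *)
Lemma dvdz_mulmx_inj (N : nat) (M : 'M[int]_g) a : prime N ->
  (`|\det M| < N)%N -> \det M != 0 ->
  (forall j, (N %| (a *m M) ord0 j)%Z) -> forall j, (N %| a ord0 j)%Z.
Proof.
move=> pN ltN det0 H j.
have : (N %| \det M * a ord0 j)%Z.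
  have -> : \det M * a ord0 j = (a *m M *m \adj M) 0 j.
    by rewrite -mulmxA mul_mx_adj mul_mx_scalar mxE.
  rewrite mxE; apply: rpred_sum => k _; exact: dvdz_mulr.
rewrite !dvdzE abszM Euclid_dvdM // => /orP[|//].
rewrite absz_nat => /dvdn_leq; rewrite absz_gt0 => /(_ det0).
by rewrite leqNgt ltN.
Qed.

(** Subtracting, N divides x times the Hankel matrix of a - b, that is a - b times an integral
    matrix invertible modulo N. *)
Lemma hankel_mod_inj (N : nat) x z a b : prime N -> x != 0 ->
  (`|\det (\sum_i x 0%R i *: C ^+ i)| < N)%N ->
  (forall j, (N %| (z - x *m hankel a) ord0 j)%Z) ->
  (forall j, (N %| (z - x *m hankel b) ord0 j)%Z) ->
  forall j, (N %| (a - b) ord0 j)%Z.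
Proof.
move=> pN x0 ltN Ha Hb.
apply: (dvdz_mulmx_inj (M := (\sum_i x 0 i *: C ^+ i)^T)) => //.
- by rewrite det_tr.
- by rewrite det_tr; exact: C_det.
move=> j; rewrite mulmxBl -!mulmx_hankel.
have -> : x *m hankel a - x *m hankel b =
    (z - x *m hankel b) - (z - x *m hankel a).
  by rewrite opprB [RHS]addrC addrA subrK.
have B (u v : 'rV[int]_g) : (u - v) ord0 j = u ord0 j - v ord0 j.
  by rewrite !mxE.
by rewrite B; apply: rpredB; [exact: Hb|exact: Ha].
Qed.

Lemma det_bounded (K : nat) : exists N : nat, forall x,
  (forall i, (`|x 0%R i| <= K)%N) ->
  (`|\det (\sum_i x 0%R i *: C ^+ i)| <= N)%N.
Proof.
pose X (u : {ffun 'I_g -> 'I_(K + K).+1}) : 'rV[int]_g := \row_i ((u i)%:Z -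
  K%:Z).
exists (\max_u `|\det (\sum_i X u 0%R i *: C ^+ i)|)%N => x xK.
pose u : {ffun 'I_g -> 'I_(K + K).+1} := [ffun i => inord (absz (x 0 i +
  K%:Z))].
have -> : x = X u.
  apply/rowP => i; by rewrite mxE ffunE inordK; have := xK i; move: (x ord0 i)
    => t; clear; lia.
exact: leq_bigmax.
Qed.

(** The standard form summed over the cyclic group generated by C. The term j = 0 is the identity,
    whence coercivity with constant 1. *)
Definition gram : 'M[int]_g := \sum_(j < n) C ^+ j *m (C ^+ j)^T.

Lemma gram_sym : gram^T = gram.
Proof.
rewrite /gram linear_sum; apply: eq_bigr => j _.
by rewrite /= trmx_mul trmxK.
Qed.

Lemma gram_invariant : C *m gram *m C^T = gram.
Proof.
rewrite /gram mulmx_sumr mulmx_suml.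
transitivity (\sum_(j < n) C ^+ j.+1 *m (C ^+ j.+1)^T).
  by apply: eq_bigr => j _; rewrite exprS trmx_mul !mulmxA.
case: (n) n_gt0 Cn => // k _ Ck.
rewrite big_ord_recr [RHS]big_ord_recl /= Ck expr0 addrC; congr (_ + _).
Qed.

End HankelFamily.

(** * Norms of lattice vectors and the common fine lattice *)

Section Averaging.
Variables (R : realType) (n g : nat) (C : 'M[int]_g).
Hypothesis n_gt0 : (0 < n)%N.
Hypothesis Cn : C ^+ n = 1.
Hypothesis C_free : forall j (x : 'rV_g),
  (0 < j < n)%N -> x *m C ^+ j = x -> x = 0.
Hypothesis C_det : forall x : 'rV_g,
  x != 0 -> \det (\sum_i x 0 i *: C ^+ i) != 0.
Hypothesis C_row : forall i j : 'I_g, row j (C ^+ i) = row i (C ^+ j).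
Implicit Types (x y z a : 'rV[int]_g) (p q : 'rV[R]_g).

Local Notation G := (gram n C).
Definition gramR : 'M[R]_g := map_mx intr G.

Let CR : 'M[R]_g := map_mx intr C.

Lemma gramR_sym : gramR^T = gramR.
Proof. by rewrite /gramR map_trmx gram_sym. Qed.

Lemma bilin_gramR p : bilin gramR p p =
  \sum_(j < n) \sum_k ((p *m map_mx intr (C ^+ j)) 0 k) ^+ 2.
Proof.
rewrite /bilin /gramR /gram raddf_sum /= mulmx_sumr mulmx_suml summxE.
apply: eq_bigr => j _; rewrite map_mxM -map_trmx mulmxA -mulmxA.
rewrite -[(map_mx _ _)^T *m _]trmxK trmx_mul !trmxK mxE.
by apply: eq_bigr => k _; rewrite [X in _ * X]mxE expr2.
Qed.

Lemma gramR_coercive p : 1 * \sum_j p 0 j ^+ 2 <= bilin gramR p p.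
Proof.
rewrite mul1r bilin_gramR; case: n n_gt0 => // k _.
rewrite big_ord_recl expr0 map_mx1 mulmx1 lerDl.
by apply: sumr_ge0 => j _; apply: sumr_ge0 => l _; exact: sqr_ge0.
Qed.

Lemma gramR_unit : gramR \in unitmx.
Proof. exact: coercive_unitmx ltr01 gramR_coercive. Qed.

Lemma scaled_coercive (s : R) p : 0 < s ->
  s * \sum_j p 0 j ^+ 2 <= bilin (s *: gramR) p p.
Proof.
by move=> s0; rewrite bilin_scale ler_pM2l // -[X in X <= _]mul1r
  gramR_coercive.
Qed.

Lemma scaled_sym (s : R) : (s *: gramR)^T = s *: gramR.
Proof. by rewrite linearZ /= gramR_sym. Qed.

Lemma CR_unit : CR \in unitmx.
Proof.
case: n n_gt0 Cn => // k _ Ck.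
suff : CR *m map_mx intr (C ^+ k) = 1%:M by case/mulmx1_unit.
rewrite /CR -map_mxM (_ : C *m C ^+ k = 1%:M) ?map_mx1 //.
by rewrite -[LHS]/(C * C ^+ k) -exprS Ck.
Qed.

Lemma bilin_gramR_C p : bilin gramR (p *m CR) (p *m CR) = bilin gramR p p.
Proof.
rewrite /bilin trmx_mul !mulmxA; congr ((_ *m _) 0 0).
rewrite -!mulmxA; congr (_ *m _).
by rewrite mulmxA /CR /gramR map_trmx -!map_mxM gram_invariant.
Qed.

Lemma bilin_inv_gramR_C p :
  bilin (invmx gramR) (p *m CR^T) (p *m CR^T) = bilin (invmx gramR) p p.
Proof.
rewrite /bilin trmx_mul trmxK !mulmxA; congr ((_ *m _) 0 0).
rewrite -!mulmxA; congr (_ *m _).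
have E : CR *m gramR *m CR^T = gramR.
  by rewrite /CR /gramR map_trmx -!map_mxM gram_invariant.
have uC := CR_unit; have uCT : CR^T \in unitmx by rewrite unitmx_tr.
have uG := gramR_unit.
have : (CR^T *m (invmx gramR *m CR)) *m (gramR *m CR^T) = CR^T.
  rewrite -!mulmxA; have -> : CR *m (gramR *m CR^T) = gramR by rewrite mulmxA.
  by rewrite mulVmx // mulmx1.
move=> h; have {}h : CR^T *m (invmx gramR *m CR) *m gramR = 1%:M.
  by apply: (can_inj (mulmxK uCT)); rewrite mul1mx -[LHS]mulmxA.
by rewrite -[LHS](mulmxK uG) h mul1mx.
Qed.

Lemma bilin_inv_gramR p :
  bilin (invmx gramR) p p = bilin gramR (p *m invmx gramR) (p *m invmx gramR).
Proof.
by rewrite /bilin mulmxKV ?gramR_unit // trmx_mul trmx_inv gramR_sym mulmxA.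
Qed.

(** By the adjugate formula the value is a non-zero integer divided by the determinant. This keeps
    the lattice vectors with x = 0 long. *)
Lemma bilin_inv_gramR_ge y : y != 0 ->
  (`|\det gramR|)^-1 <= bilin (invmx gramR) (intr_row R y) (intr_row R y).
Proof.
move=> y0; pose b := bilin (invmx gramR) (intr_row R y) (intr_row R y).
have b_gt0 : 0 < b.
  have b0 : 0 <= b.
    by rewrite /b bilin_inv_gramR; exact: bilin_ge0 ltr01 gramR_coercive _.
  rewrite lt_neqAle b0 andbT eq_sym; apply: contra_neq y0 => e.
  have : intr_row R y *m invmx gramR = 0.
    by apply: (bilin_eq0 ltr01 gramR_coercive); rewrite -bilin_inv_gramR.
  move/(congr1 (mulmx^~ gramR)); rewrite mul0mx mulmxKV ?gramR_unit // => /rowP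
    yE.
  by apply/rowP => j; have /eqP := yE j; rewrite !mxE intr_eq0 => /eqP.
have D0 : \det gramR != 0 by have := gramR_unit; rewrite unitmxE unitfE.
pose k : int := (y *m \adj G *m y^T) 0 0.
have bE : b = (\det gramR)^-1 * k%:~R.
  rewrite /b /bilin /invmx gramR_unit -scalemxAr -scalemxAl mxE; congr (_ * _).
  rewrite /k /gramR -map_mx_adj /intr_row map_trmx -!map_mxM mxE.
  by [].
have k0 : k != 0 by apply: contraTneq b_gt0 => k0; rewrite bE k0 mulr0 ltxx.
rewrite -/b -(gtr0_norm b_gt0) bE normrM normfV ler_peMr ?invr_ge0 //.
by rewrite -intr_norm ler1z; lia.
Qed.

(** In the fine lattice, of slope 0, the norm separates x from z, so C and C^T may act on the two
    coordinates independently. *)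
Lemma quad_lat_vec (s b : R) x z : 0 < s -> b != 0 ->
  quad (s *: gramR) (lat_vec (b *: (s *: gramR)) 0 x z) =
    s * bilin gramR (intr_row R x) (intr_row R x)
    + (b ^+ 2 * s)^-1 * bilin (invmx gramR) (intr_row R z) (intr_row R z).
Proof.
move=> s0 b0; rewrite /quad re_complex_row im_complex_row mulmx0 addr0.
rewrite !bilin_scale; congr (_ + _).
have -> : invmx (b *: (s *: gramR)) = (b * s)^-1 *: invmx gramR.
  rewrite scalerA invmxZ // unitmxZ ?gramR_unit // unitfE.
  by rewrite mulf_neq0 // gt_eqF.
rewrite -scalemxAr bilinZl bilinZr -bilin_inv_gramR !mulrA; congr (_ * _).
by field; rewrite b0 gt_eqF.
Qed.

Definition hankel_slope (N : nat) a : 'M[R]_g :=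
  N%:R^-1 *: map_mx intr (hankel C a).

Lemma hankel_slope_sym N a : (hankel_slope N a)^T = hankel_slope N a.
Proof. by rewrite /hankel_slope linearZ /= map_trmx hankel_sym. Qed.

(** Lattices of all slopes embed in one lattice, where belonging to that of slope a reads z = x
    [hankel C a] modulo N. *)
Lemma lat_vec_fine (T : 'M[R]_g) (N : nat) a x y : (0 < N)%N -> T \in unitmx ->
  lat_vec T (hankel_slope N a) x y =
  lat_vec (N%:R *: T) 0 x (N%:Z *: y + x *m hankel C a).
Proof.
move=> N0 uT; have NR : N%:R != 0 :> R by rewrite pnatr_eq0 -lt0n.
rewrite /lat_vec; congr complex_row; rewrite mulmx0 addr0 invmxZ; last first.
  by rewrite unitmxZ // unitfE.
rewrite -[RHS]scalemxAr [RHS]scalemxAl; congr (_ *m _).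
rewrite /intr_row map_mxD map_mxZ map_mxM scalerDr scalerA /=.
by rewrite /hankel_slope -scalemxAr -[N%:Z%:~R]/(N%:R) mulVf // scale1r.
Qed.

Lemma lat_vec_inj (T A : 'M[R]_g) x y x' y' : T \in unitmx ->
  lat_vec T A x y = lat_vec T A x' y' -> x = x' /\ y = y'.
Proof.
move=> uT e; have inj (u v : 'rV[int]_g) : intr_row R u = intr_row R v -> u = v.
  move=> /rowP uv; apply/rowP => j; have := uv j; rewrite !mxE => /eqP.
  by rewrite eqr_int => /eqP.
have xx : x = x'.
  by apply: inj; have := congr1 (@re_row R g) e; rewrite !re_complex_row.
split=> //; apply: inj; have := congr1 (@im_row R g) e; rewrite !im_complex_row
  xx.
by move/(congr1 (mulmx^~ T)); rewrite !mulmxKV // => /addIr.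
Qed.

End Averaging.

(** * The pigeonhole over slopes *)

Section GoodSlope.
Variables (R : realType) (n g : nat) (C : 'M[int]_g).
Hypothesis n_gt0 : (0 < n)%N.
Hypothesis Cn : C ^+ n = 1.
Hypothesis C_free : forall j (x : 'rV_g),
  (0 < j < n)%N -> x *m C ^+ j = x -> x = 0.
Hypothesis C_det : forall x : 'rV_g,
  x != 0 -> \det (\sum_i x 0 i *: C ^+ i) != 0.
Hypothesis C_row : forall i j : 'I_g, row j (C ^+ i) = row i (C ^+ j).
Implicit Types (x y z : 'rV[int]_g).

Local Notation Q := (gramR R n C).

Lemma lat_vec0 (T A : 'M[R]_g) : lat_vec T A 0 0 = 0.
Proof.
have e : intr_row R 0 = 0 :> 'rV_g by apply/rowP => j; rewrite !mxE.
rewrite /lat_vec e mul0mx addr0 mul0mx; apply/rowP => j; rewrite !mxE.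
by [].
Qed.

Lemma bilin_orbit x k : 
  bilin Q (intr_row R (x *m C ^+ k)) (intr_row R (x *m C ^+ k))
  = bilin Q (intr_row R x) (intr_row R x).
Proof.
elim: k => [|k IH]; first by rewrite expr0 mulmx1.
rewrite -IH -[RHS](bilin_gramR_C n_gt0 Cn).
by rewrite exprSr -[C ^+ k * C]/(C ^+ k *m C) mulmxA /intr_row map_mxM.
Qed.

Lemma bilin_inv_orbit z k :
  bilin (invmx Q) (intr_row R (z *m (C ^+ k)^T)) (intr_row R (z *m (C ^+ k)^T))
  = bilin (invmx Q) (intr_row R z) (intr_row R z).
Proof.
elim: k => [|k IH]; first by rewrite expr0 trmx1 mulmx1.
rewrite -IH -[RHS](bilin_inv_gramR_C n_gt0 Cn).
rewrite exprS -[C * C ^+ k]/(C *m C ^+ k) trmx_mul mulmxA /intr_row map_mxM.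
by rewrite map_trmx.
Qed.

(* Were every slope bad, the orbits of the n isometries would give n N^g nonzero
   short vectors of the fine lattice: for x <> 0 and N prime to the norm of x, a
   pair (x, z) comes from at most one slope mod N.  The last hypothesis rules
   this out by volume, the previous one excludes vectors with x = 0. *)
Lemma exists_good_slope (s lam : R) (N : nat) : prime N -> 0 < s -> 0 < lam ->
  (forall x, x != 0 -> s * bilin Q (intr_row R x) (intr_row R x) < lam ^+ 2 ->
     (`|\det (\sum_i x 0%R i *: C ^+ i)| < N)%N) ->
  lam ^+ 2 <= (s * `|\det Q|)^-1 ->
  (lam + Num.sqrt (mx_abs (s *: Q) + (N%:R ^+ 2)^-1 * mx_abs (invmx (s *: Q))))
      ^+ (g + g) * ball_volume (s *: Q) <= n%:R * covolume (s *: Q) ->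
  exists a, forall v, lat (s *: Q) (hankel_slope R C N a) v -> v != 0 ->
    lam <= qnorm (s *: Q) v.
Proof.
move=> pN s0 lam0 detN lam_det; set d := Num.sqrt _ => volume_le.
have N0 := prime_gt0 pN; have NR : 0 < N%:R :> R by rewrite ltr0n.
have Qs_sym := scaled_sym n C s.
have Qs_coer p := scaled_coercive C n_gt0 p s0.
have uQs := coercive_unitmx s0 Qs_coer.
have uT : N%:R *: (s *: Q) \in unitmx by rewrite unitmxZ // unitfE gt_eqF.
pose row_of (a : {ffun 'I_g -> 'I_N}) : 'rV[int]_g := \row_i (a i)%:Z.
have row_inj a b : (forall j, (N %| (row_of a - row_of b) ord0 j)%Z) -> a = b.
  move=> H; apply/ffunP => i; apply: val_inj; have := H i.
  rewrite !mxE dvdzE absz_nat /=; move: (ltn_ord (a i)) (ltn_ord (b i)).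
  move: (nat_of_ord (a i)) (nat_of_ord (b i)) => u v uN vN h.
  case: (posnP (absz (u%:Z - v%:Z))) => [|p0]; first by clear -v; lia.
  by have := dvdn_leq p0 h; clear -uN vN; lia.
apply: contrapT => /forallNP bad.
have bad' (a : {ffun 'I_g -> 'I_N}) : exists xy : 'rV[int]_g * 'rV[int]_g,
    let v := lat_vec (N%:R *: (s *: Q)) 0 xy.1
      (N%:Z *: xy.2 + xy.1 *m hankel C (row_of a)) in
    v != 0 /\ qnorm (s *: Q) v < lam.
  have /existsNP[v] := bad (row_of a).
  move=> /not_implyP[[x [y ->]]] /not_implyP[v0 /negP]; rewrite -ltNge => v_lt.
  by exists (x, y); rewrite /= -lat_vec_fine.
have {bad bad'}[f fP] := choice bad'.
pose X a := (f a).1; pose Z a := N%:Z *: (f a).2 + X a *m hankel C (row_of a).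
have quadE x z : quad (s *: Q) (lat_vec (N%:R *: (s *: Q)) 0 x z) =
    s * bilin Q (intr_row R x) (intr_row R x)
    + (N%:R ^+ 2 * s)^-1 * bilin (invmx Q) (intr_row R z) (intr_row R z).
  by apply: quad_lat_vec => //; rewrite gt_eqF.
have inv_ge0 z : 0 <= bilin (invmx Q) (intr_row R z) (intr_row R z).
  rewrite bilin_inv_gramR //; exact: (bilin_ge0 ltr01 (gramR_coercive C n_gt0)).
have Xshort a : s * bilin Q (intr_row R (X a)) (intr_row R (X a)) < lam ^+ 2.
  have [_] := fP a; rewrite (qnorm_lt s0 Qs_coer) // quadE -/(X a) => h.
  apply: le_lt_trans h; rewrite lerDl mulr_ge0 // invr_ge0.
  by rewrite mulr_ge0 ?exprn_ge0 ?(ltW NR) ?(ltW s0).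
(* With x = 0 the slope drops out and z = N y, so the squared norm is y Q^-1 y^T / s >= 1 / (s |det
   Q|) >= lam^2. *)
have X0 a : X a != 0.
  apply/negP => /eqP Xa; have [v0] := fP a.
  rewrite -/(X a) Xa mul0mx addr0 in v0 *.
  rewrite (qnorm_lt s0 Qs_coer) // quadE => h.
  have y0 : (f a).2 != 0.
    by apply: contra_neq v0 => ->; rewrite scaler0 lat_vec0.
  have := bilin_inv_gramR_ge R C n_gt0 y0 => hy.
  have zero : bilin Q (intr_row R 0) (intr_row R 0) = 0.
    by rewrite /bilin /intr_row map_mx0 !mul0mx mxE.
  move: h; rewrite zero mulr0 add0r.
  have -> : intr_row R (N%:Z *: (f a).2) = N%:R *: intr_row R (f a).2.
    by rewrite /intr_row map_mxZ.
  rewrite bilinZl bilinZr => h.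
  have : s^-1 * (`|\det Q|)^-1 <= s^-1 * bilin (invmx Q) (intr_row R (f a).2)
    (intr_row R (f a).2).
    by rewrite ler_wpM2l // invr_ge0 ltW.
  rewrite -invfM => h2; have := le_trans lam_det h2; rewrite leNgt.
  move/negP; apply; apply: le_lt_trans h.
  rewrite le_eqVlt; apply/orP; left; apply/eqP; field.
  by rewrite !gt_eqF.
pose w (a : {ffun 'I_g -> 'I_N}) (k : nat) :=
  lat_vec (N%:R *: (s *: Q)) 0 (X a *m C ^+ k) (Z a *m (C ^+ k)^T).
(* The isometries preserve each sublattice, as C commutes with the Hankel matrix up to
   transposition. So the vector determines a, and then k by freeness of the action. *)
have w_inj a b k l : (k < n)%N -> (l < n)%N -> w a k = w b l -> a = b /\ k = l.
  move=> kn ln /(lat_vec_inj uT) [eX eZ].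
  have E c m : Z c *m (C ^+ m)^T - X c *m C ^+ m *m hankel C (row_of c) =
      N%:Z *: ((f c).2 *m (C ^+ m)^T).
    rewrite /Z mulmxDl -scalemxAl -!mulmxA (expC_hankel C_row).
    by rewrite addrK.
  have dvd c m j : (N %| (Z c *m (C ^+ m)^T - X c *m C ^+ m *m hankel C (row_of
    c))
      ord0 j)%Z.
    by rewrite E mxE; exact: dvdz_mulr.
  have ab : a = b.
    apply: row_inj.
    apply: (hankel_mod_inj C_det (x := X a *m C ^+ k) (z := Z a *m (C ^+ k)^T))
      => //.
    - exact: (expC_unit n_gt0 Cn k (X0 a)).
    - apply: detN; first exact: (expC_unit n_gt0 Cn k (X0 a)).
      by rewrite bilin_orbit.
    by move=> j; rewrite eX eZ; exact: dvd.
  split => //; rewrite -ab in eX.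
  exact: (expC_inj Cn C_free kn ln (X0 a) eX).
have w_short a k : qnorm (s *: Q) (w a k) < lam.
  have [_] := fP a; rewrite /w !(qnorm_lt s0 Qs_coer) // !quadE bilin_orbit
    bilin_inv_orbit.
  by [].
(* The zero vector brings the count to n N^g + 1, which contradicts the non-strict volume
   hypothesis. *)
pose sq := 0 :: [seq w a k | a <- enum {ffun 'I_g -> 'I_N}, k <- iota 0 n].
have szq : size sq = (N ^ g * n).+1.
  by rewrite /= size_allpairs size_iota -cardE card_ffun !card_ord.
have w_neq0 a k : w a k != 0.
  apply/eqP => w0.
  have w0' : w a k = lat_vec (N%:R *: (s *: Q)) 0 0 0.
    by rewrite w0 lat_vec0.
  have [Xk _] := lat_vec_inj uT w0'.
  by have := expC_unit n_gt0 Cn k (X0 a); rewrite Xk eqxx.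
have usq : uniq sq.
  rewrite /sq cons_uniq; apply/andP; split.
    apply/negP => /allpairsP[[a k] /= [_ _ e0]].
    by have := w_neq0 a k; rewrite -e0 eqxx.
  apply: allpairs_uniq; rewrite ?enum_uniq ?iota_uniq //.
  move=> [a k] [b l] /allpairsP[[a' k'] /= [_ k'n [-> ->]]].
  move=> /allpairsP[[b' l'] /= [_ l'n [-> ->]]] e.
  rewrite !mem_iota !add0n in k'n l'n.
  by have [-> ->] := w_inj _ _ _ _ k'n l'n e.
have sqL v : v \in sq -> lat (N%:R *: (s *: Q)) 0 v /\ qnorm (s *: Q) v < lam.
  rewrite in_cons => /orP[/eqP ->|/allpairsP[[a k] /= [_ _ ->]]].
    split; last first.
      rewrite (qnorm_lt s0 Qs_coer) // /quad /bilin.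
      have -> : re_row 0 = 0 :> 'rV[R]_g by apply/rowP => j; rewrite !mxE.
      have -> : im_row 0 = 0 :> 'rV[R]_g by apply/rowP => j; rewrite !mxE.
      by rewrite !mul0mx !mxE addr0 exprn_gt0.
    by exists 0, 0; rewrite lat_vec0.
  by split => //; exists (X a *m C ^+ k), (Z a *m (C ^+ k)^T).
have Fd u : par_tile (N%:R *: (s *: Q)) u -> qnorm (s *: Q) u <= d.
  exact: qnorm_par_tile_le.
have := count_le Qs_sym s0 Qs_coer (lat_is_tile 0 uT) Fd usq sqL.
have lamd : 0 < lam + d by rewrite ltr_pwDl // sqrtr_ge0.
rewrite Cg_volume_par_tile_scale // covolumeE //.
rewrite (Cg_volume_qball s0 Qs_coer lamd) (ball_volumeE s0 Qs_coer).
rewrite -!EFinM lee_fin szq => /le_trans/(_ volume_le).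
have V0 := covolume_gt0 uQs.
have Ng0 : 0 < N%:R ^+ g :> R by rewrite exprn_gt0.
rewrite mulrA ler_pM2r // ler_pdivrMr // -natrX -natrM ler_nat mulnC ltnn.
by [].
Qed.

End GoodSlope.

(** * Choice of the radius, and the limit in m *)

Section InjectivityVolumeBound.
Variables (R : realType) (n g : nat) (C : 'M[int]_g).
Hypothesis n_gt0 : (0 < n)%N.
Hypothesis g_gt0 : (0 < g)%N.
Hypothesis Cn : C ^+ n = 1.
Hypothesis C_free : forall j (x : 'rV_g),
  (0 < j < n)%N -> x *m C ^+ j = x -> x = 0.
Hypothesis C_det : forall x : 'rV_g,
  x != 0 -> \det (\sum_i x 0 i *: C ^+ i) != 0.
Hypothesis C_row : forall i j : 'I_g, row j (C ^+ i) = row i (C ^+ j).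

Local Notation Q := (gramR R n C).
Let Q_coer := gramR_coercive (R := R) C n_gt0.
Let Q_unit : Q \in unitmx := gramR_unit R C n_gt0.

Lemma mx_abs_scale (s : R) (T : 'M[R]_g) :
  0 <= s -> mx_abs (s *: T) = s * mx_abs T.
Proof.
move=> s0; rewrite /mx_abs mulr_sumr; apply: eq_bigr => i _; rewrite mulr_sumr.
by apply: eq_bigr => j _; rewrite mxE normrM ger0_norm.
Qed.

Lemma ball_volume_scale (m : R) : 0 < m ->
  ball_volume ((m ^+ 2)^-1 *: Q) = m ^+ (g + g) * ball_volume Q.
Proof.
move=> m0; have m2 : 0 < (m ^+ 2)^-1 by rewrite invr_gt0 exprn_gt0.
have coer p := scaled_coercive C n_gt0 p m2.
rewrite /ball_volume; have -> : qball ((m ^+ 2)^-1 *: Q) 1 = qball Q m.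
  apply/seteqP; split => z; rewrite /qball /=;
    rewrite (qnorm_lt m2 coer) // (qnorm_lt ltr01 Q_coer) // quad_scale expr1n;
    by rewrite ltr_pdivrMl ?exprn_gt0 // mulr1.
rewrite (Cg_volume_qball ltr01 Q_coer m0) (ball_volumeE ltr01 Q_coer).
by rewrite -EFinM.
Qed.

Lemma covolume_scale (m : R) : 0 < m ->
  covolume ((m ^+ 2)^-1 *: Q) = m ^+ (g + g) * covolume Q.
Proof.
move=> m0; have m2 : 0 < (m ^+ 2)^-1 by rewrite invr_gt0 exprn_gt0.
rewrite {1}/covolume Cg_volume_par_tile_scale // covolumeE // -EFinM /=.
by rewrite exprVn invrK -exprM mul2n addnn.
Qed.

Lemma exists_prime_bound (K m : nat) : exists N : nat,
  [/\ prime N, (m <= N)%N & forall x : 'rV[int]_g,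
    (forall i, (`|x 0%R i| <= K)%N) -> (`|\det (\sum_i x 0%R i *: C ^+ i)| <
      N)%N].
Proof.
have [B BP] := det_bounded C K; have [N NB pN] := prime_above (maxn B m).
exists N; split=> //; first exact: leq_trans (leq_maxr B m) (ltnW NB).
by move=> x /BP h; apply: leq_ltn_trans h (leq_ltn_trans (leq_maxl B m) NB).
Qed.

(** Dividing Q by m^2 multiplies both volumes by m^(2g), so that kappa is common to all m. *)
Let kappa := ball_volume Q / covolume Q.
Let c := Num.sqrt (mx_abs Q + mx_abs (invmx Q)).

(** At radius rho the ball has n times the covolume. Since c/m bounds the tile diameter d, taking
    lam = rho - c/m gives lam + d <= rho. The last two hypotheses give rho^2 |det Q| <= m^2, which
    excludes vectors with x = 0. *)
Lemma sup_volume_ge_lam (rho : R) (m : nat) : 0 < rho ->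
  rho ^+ (g + g) * kappa = n%:R -> c < rho * m%:R ->
  rho * `|\det Q| <= m%:R -> rho <= m%:R ->
  ((((rho - c / m%:R) / 2) ^+ (g + g) * kappa)%:E
    <= sup_injectivity_volume R g)%E.
Proof.
move=> rho0 rhoE cm detm rhom.
have B0 := ball_volume_gt0 ltr01 Q_coer; have V0 := covolume_gt0 Q_unit.
have m0 : 0 < m%:R :> R by apply: lt_le_trans rhom.
have m1 : 1 <= m%:R :> R by rewrite ler1n -(ltr0n R).
have s0 : 0 < (m%:R ^+ 2)^-1 :> R by rewrite invr_gt0 exprn_gt0.
set s := (m%:R ^+ 2)^-1 in s0 *.
have s_coer p := scaled_coercive C n_gt0 p s0.
have s_sym := scaled_sym n C s.
pose lam := rho - c / m%:R.
have c0 : 0 <= c by exact: sqrtr_ge0.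
have lam0 : 0 < lam by rewrite subr_gt0 ltr_pdivrMr.
have lam_rho : lam <= rho by rewrite gerBl divr_ge0.
have lam2 : lam ^+ 2 <= rho ^+ 2 by rewrite ler_pXn2r // nnegrE ltW.
(* As Q dominates the identity, the x of a short vector has entries below rho m. The condition N >=
   m^2 below makes both terms of the tile diameter of order 1/m. *)
pose K := (Num.truncn (rho * m%:R)).+1.
have [N [pN mN detN]] := exists_prime_bound K (m ^ 2).
have N0 : 0 < N%:R :> R by rewrite ltr0n prime_gt0.
have [a aP] : exists a, forall v, lat (s *: Q) (hankel_slope R C N a) v ->
    v != 0 -> lam <= qnorm (s *: Q) v.
  apply: (exists_good_slope n_gt0 Cn C_free C_det C_row pN s0 lam0).
  - move=> x x0 xs; apply: detN => i.
    have h1 := entry_sqr_le ltr01 Q_coer (intr_row R x) i.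
    rewrite mul1r in h1.
    have h2 : (intr_row R x 0 i) ^+ 2 < (rho * m%:R) ^+ 2.
      apply: le_lt_trans h1 _; move: (lt_le_trans xs lam2).
      by rewrite /s ltr_pdivrMl ?exprn_gt0 // exprMn mulrC.
    have : `|intr_row R x 0 i| < K%:R.
      apply: lt_trans (truncnS_gt _).
      rewrite -(@ltr_pXn2r _ 2) ?nnegrE ?mulr_ge0 ?(ltW rho0) ?(ltW m0) //.
      by rewrite real_normK ?num_real.
    rewrite mxE -intr_norm -[K%:R]/(K%:Z%:~R) ltr_int.
    by clear; lia.
  - apply: le_trans lam2 _; rewrite invfM invrK.
    have D0 : 0 < `|\det Q|.
      by rewrite normr_gt0; have := Q_unit; rewrite unitmxE unitfE.
    rewrite ler_pdivlMr // (expr2 rho) (expr2 m%:R) -mulrA mulrC [X in _ <=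
      X]mulrC.
    by apply: ler_pM => //; rewrite ?mulr_ge0 ?(ltW rho0).
  rewrite ball_volume_scale // covolume_scale // mulrCA (mulrCA n%:R).
  rewrite ler_pM2l ?exprn_gt0 //.
  have -> : n%:R * covolume Q = rho ^+ (g + g) * ball_volume Q.
    by rewrite -rhoE /kappa mulrA divfK // gt_eqF.
  rewrite ler_pM2r // lerXn2r ?nnegrE ?(addr_ge0 (ltW lam0) (sqrtr_ge0 _))
    ?(ltW rho0) //.
  rewrite -lerBrDl (_ : rho - lam = c / m%:R); last by rewrite /lam subKr.
  have -> : c / m%:R = Num.sqrt ((mx_abs Q + mx_abs (invmx Q)) / m%:R ^+ 2).
    rewrite sqrtrM ?addr_ge0 ?mx_abs_ge0 // sqrtrV ?exprn_ge0 ?(ltW m0) //.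
    by rewrite sqrtr_sqr gtr0_norm.
  rewrite ler_wsqrtr //.
  have -> : invmx (s *: Q) = m%:R ^+ 2 *: invmx Q.
    by rewrite invmxZ ?invrK // unitmxZ // unitfE gt_eqF.
  rewrite !mx_abs_scale ?(ltW s0) ?exprn_ge0 ?(ltW m0) //.
  rewrite mulrDl mulrC lerD2l mulrA mulrC; apply: ler_wpM2l; first exact:
    mx_abs_ge0.
  have mN' : m%:R ^+ 2 <= N%:R :> R by rewrite -natrX ler_nat.
  have m20 : 0 < m%:R ^+ 2 :> R by rewrite exprn_gt0.
  rewrite mulrC ler_pdivrMr ?exprn_gt0 // ler_pdivlMl // -expr2.
  by rewrite lerXn2r // nnegrE ltW.
have A_sym := hankel_slope_sym R C_row N a.
apply: le_trans (ereal_sup_ubound _); last first.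
  by exists (lat_ppav s_sym s0 s_coer A_sym).
apply: le_trans (injectivity_volume_lat_ge _ _ _ _ g_gt0 lam0 aP).
rewrite lee_fin ball_volume_scale // covolume_scale // -mulrA.
rewrite -mulf_div divff ?mul1r // gt_eqF // exprn_gt0 //.
Qed.

(** As m grows the bound of [sup_volume_ge_lam], multiplied by 4^g, tends to rho^(2g) kappa = n. *)
Lemma sup_volume_ge :
  (n%:R%:E <= (4 ^+ g)%:E * sup_injectivity_volume R g)%E.
Proof.
have B0 := ball_volume_gt0 ltr01 Q_coer; have V0 := covolume_gt0 Q_unit.
have k0 : 0 < kappa by rewrite divr_gt0.
have nR : 0 < n%:R :> R by rewrite ltr0n.
pose rho := powR (n%:R / kappa) ((g + g)%:R^-1).
have rho0 : 0 < rho by apply: powR_gt0; exact: divr_gt0.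
have rhoE : rho ^+ (g + g) * kappa = n%:R.
  rewrite /rho -powR_mulrn ?powR_ge0 // -powRrM mulVf; last first.
    by rewrite pnatr_eq0 addnn double_eq0 -lt0n.
  by rewrite powRr1 ?divfK ?gt_eqF // divr_ge0 // ltW.
have c0 : 0 <= c by exact: sqrtr_ge0.
apply/lee_addgt0Pr => eps eps0.
pose G2 : R := (g + g)%:R.
(* The first three terms secure the hypotheses on m; the fourth makes the Bernoulli loss 2g n c /
   (rho m) at most eps. *)
pose M := c / rho + rho * `|\det Q| + rho + n%:R * G2 * c / rho / eps + 1.
have h1 : 0 <= c / rho by rewrite divr_ge0 // ltW.
have h2 : 0 <= rho * `|\det Q| by rewrite mulr_ge0 // ltW.
have h3 : 0 <= n%:R * G2 * c / rho / eps.
  by rewrite !divr_ge0 ?(ltW rho0) ?(ltW eps0) // !mulr_ge0 // ler0n.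
pose m := (Num.truncn M).+1.
have Mm : M < m%:R by exact: truncnS_gt.
have m0 : 0 < m%:R :> R by rewrite ltr0n.
have cm : c < rho * m%:R by rewrite mulrC -ltr_pdivrMr //; rewrite /M in Mm;
  lra.
have := sup_volume_ge_lam rho0 rhoE cm (_ : _ <= m%:R) (_ : _ <= m%:R).
rewrite /M in Mm; move=> H; have {}H := H ltac:(lra) ltac:(lra).
have four : 0 <= (4 : R) ^+ g by rewrite exprn_ge0.
have := lee_wpmul2l (_ : (0 <= (4 ^+ g)%:E)%E) H; rewrite lee_fin => /(_ four).
set V := (_ * sup_injectivity_volume R g)%E; rewrite -EFinM => H'.
apply: le_trans (leeD2r _ H'); rewrite -EFinD lee_fin.
have -> : 4 ^+ g * (((rho - c / m%:R) / 2) ^+ (g + g) * kappa) =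
    n%:R * (1 - c / (rho * m%:R)) ^+ (g + g).
  have -> : (4 : R) ^+ g = 2 ^+ (g + g) by rewrite addnn -mul2n exprM; congr (_
    ^+ _); ring.
  have -> : rho - c / m%:R = rho * (1 - c / (rho * m%:R)).
    by field; rewrite !gt_eqF.
  rewrite -rhoE !exprMn exprVn; field.
  by rewrite expf_neq0.
have Bern : 1 - G2 * (c / (rho * m%:R)) <= (1 - c / (rho * m%:R)) ^+ (g + g).
  apply: Bernoulli_le; rewrite divr_ge0 ?mulr_ge0 ?(ltW rho0) //=.
  by rewrite ler_pdivrMr ?mulr_gt0 // mul1r ltW.
have : n%:R * (1 - G2 * (c / (rho * m%:R))) <= n%:R * (1 - c / (rho * m%:R)) ^+
  (g + g).
  by rewrite ler_pM2l.
suff : n%:R * (G2 * (c / (rho * m%:R))) <= eps by lra.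
have : n%:R * G2 * c / rho / eps <= m%:R by lra.
rewrite ler_pdivrMr // -ler_pdivrMl // => h.
apply: le_trans h; rewrite le_eqVlt; apply/orP; left; apply/eqP.
by field; rewrite !gt_eqF.
Qed.

End InjectivityVolumeBound.

Theorem mainTheorem3 (R : realType) :
  exists c : R, infinite_set [set g : nat | (1 <= g)%N /\
    ((expR (euler_gamma R) * g%:R * ln (ln g%:R) - c * g%:R)%:E
       <= (4 ^+ g)%:E * sup_injectivity_volume R g)%E].
Proof.
exists (3 * expR (euler_gamma R)) => /finite_seqP[s sE].
have [n [n0 sn nle]] := totient_ratio_frequently R (\max_(k <- s) k).+1.
have tn : (0 < totient n)%N by rewrite totient_gt0.
have : totient n \in s.
  suff : [set` s] (totient n) by [].
  rewrite -sE; split => //.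
  have [C [Cn Cfree Cdet Crow]] := cyclotomic_mx n0.
  apply: le_trans (sup_volume_ge R n0 tn Cn Cfree Cdet Crow).
  by rewrite lee_fin.
by move=> /(@leq_bigmax_seq _ _ xpredT id)/(_ isT); rewrite leqNgt sn.
Qed.
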